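(* Let $n \ge 1$, let $\mathcal{H}_1$ and $\mathcal{H}_2$ be Hilbert spaces, and let $$T=\begin{bmatrix} A & D_{A^*} L D_B\\ 0 & B\end{bmatrix} : \Big(\bigoplus_{1}^n \mathcal{H}_1\Big)\oplus\Big(\bigoplus_1^n\mathcal{H}_2\Big)\to \mathcal{H}_1\oplus\mathcal{H}_2$$ be a row contraction on $\mathcal{H}_1\oplus\mathcal{H}_2$, where $A=(A_1,\ldots,A_n)$ on $\mathcal{H}_1$ and $B=(B_1,\ldots,B_n)$ on $\mathcal{H}_2$ are row contractions and $L\in\mathcal{B}(\mathcal{D}_B,\mathcal{D}_{A^*})$ is a contraction. Let $\sigma:\mathcal{D}_T\to\mathcal{D}_A\oplus\mathcal{D}_L$ and $\sigma_*:\mathcal{D}_{T^*}\to\mathcal{D}_{B^*}\oplus\mathcal{D}_{L^*}$ be the unitary operators determined by $$\sigma D_T=\begin{bmatrix} D_A & -A^*LD_B\\ 0 & D_LD_B\end{bmatrix},\qquad \sigma_*D_{T^*}=\begin{bmatrix} -BL^*D_{A^*} & D_{B^*}\\ D_{L^*}D_{A^*} & 0\end{bmatrix}.$$ Then $$\Theta_T=(I_\Gamma\otimes\sigma_*^{-1})\begin{bmatrix}\Theta_B & 0\\ 0 & I_{\Gamma\otimes\mathcal{D}_{L^*}}\end{bmatrix}(I_\Gamma\otimes J_L)\begin{bmatrix}\Theta_A & 0\\ 0 & I_{\Gamma\otimes\mathcal{D}_L}\end{bmatrix}(I_\Gamma\otimes\sigma),$$ where $\Theta_T,\Theta_A,\Theta_B$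 are the characteristic functions of $T,A,B$ and $J_L$ is the Julia-Halmos matrix corresponding to $L$.
   Context: $\mathcal{B}(\mathcal{H},\mathcal{K})$ denotes the bounded linear operators from $\mathcal{H}$ to $\mathcal{K}$. Row contractions. A row operator $T=(T_1,\ldots,T_n)$ on a Hilbert space $\mathcal{H}$ ($T_j\in\mathcal{B}(\mathcal{H})$) is viewed as the operator $\bigoplus_1^n\mathcal{H}\to\mathcal{H}$, $(h_1,\ldots,h_n)\mapsto\sum_j T_jh_j$; it is a row contraction if this operator is a contraction. Here $\bigoplus_1^n(\mathcal{H}_1\oplus\mathcal{H}_2)$ is identified with $(\bigoplus_1^n\mathcal{H}_1)\oplus(\bigoplus_1^n\mathcal{H}_2)$, so a row operator $\begin{bmatrix} A & X\\ 0& B\end{bmatrix}$ with $X=(X_1,\ldots,X_n)$ is the $n$-tuple $T_j=\begin{bmatrix} A_j & X_j\\ 0 & B_j\end{bmatrix}$. Defect operators. For a contraction $C:\mathcal{H}\to\mathcal{K}$, $D_C=(I-C^*C)^{1/2}\in\mathcal{B}(\mathcal{H})$, $D_{C^*}=(I-CC^* )^{1/2}\in\mathcal{B}(\mathcal{K})$, $\mathcal{D}_C=\overline{\mathrm{ran}}\,D_C$ and $\mathcal{D}_{C^*}=\overline{\mathrm{ran}}\,D_{C^*}$. For a row contraction $T$ on $\mathcal{H}$, $\mathcal{D}_T\subseteq\bigoplus_1^n\mathcal{H}$ and $\mathcal{D}_{T^*}\subseteq\mathcal{H}$. For $L\in\mathcal{B}(\mathcal{D}_B,\mathcal{D}_{A^*})$,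 $\mathcal{D}_L\subseteq\mathcal{D}_B$ and $\mathcal{D}_{L^*}\subseteq\mathcal{D}_{A^*}$. The existence of the unitaries $\sigma,\sigma_*$ is a known result of Sz.-Nagy and Foias. Julia-Halmos matrix. $J_L=\begin{bmatrix} L^* & D_L\\ D_{L^*} & -L\end{bmatrix}:\mathcal{D}_{A^*}\oplus\mathcal{D}_L\to\mathcal{D}_B\oplus\mathcal{D}_{L^*}$ (with $D_L$ and $L$ in the second column restricted to $\mathcal{D}_L$), a unitary operator. Fock space. $\Gamma=\bigoplus_{m=0}^\infty(\mathbb{C}^n)^{\otimes m}$ is the full Fock space over $\mathbb{C}^n$, $\{e_1,\ldots,e_n\}$ is the standard basis of $\mathbb{C}^n$, and $R_jf=f\otimes e_j$ is the right creation operator on $\Gamma$. Characteristic function. For a row contraction $T$ on $\mathcal{H}$, let $\tilde T=(I_\Gamma\otimes T_1,\ldots,I_\Gamma\otimes T_n)$ and $\tilde R=(R_1\otimes I_{\mathcal{H}},\ldots,R_n\otimes I_{\mathcal{H}})$, row operators on $\Gamma\otimes\mathcal{H}$, with $\bigoplus_1^n(\Gamma\otimes\mathcal{H})$ identified with $\Gamma\otimes\bigoplus_1^n\mathcal{H}$. For $0\le r<1$ put $\Theta_T(rR)=-\tilde T+D_{\tilde T^*}(I_{\Gamma\otimes\mathcal{H}}-r\tilde R\tilde T^* )^{-1}r\tilde R D_{\tilde T}$. The characteristic function of $T$ is $\Theta_T=\mathrm{SOT}\text{-}\lim_{r\to1^-}\Theta_T(rR)$, as an operator from $\Gamma\otimes\mathcal{D}_T$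 to $\Gamma\otimes\mathcal{D}_{T^*}$. (It is known that this limit exists.) *)

(* Defs.v *)
From HB Require Import structures.
From mathcomp Require Import all_boot all_order all_algebra complex.
From mathcomp Require Import boolp classical_sets functions reals topology.
From mathcomp Require Import normedtype sequences ring lra.

Set Implicit Arguments.
Unset Strict Implicit.
Unset Printing Implicit Defensive.

Import Order.TTheory GRing.Theory Num.Theory.
Import numFieldNormedType.Exports.

Local Open Scope classical_set_scope.
Local Open Scope ring_scope.

Section InnerNorm.
Variables (R : realType) (H : lmodType R[i]) (ip : H -> H -> R[i]).
Hypothesis ipDZl : forall (a : R[i]) (x y z : H),
  ip (a *: x + y) z = a * ip x z + ip y z.
Hypothesis ipC : forall x y : H, ip y x = (ip x y)^*.
Hypothesis ip_gt0 : forall x : H, x != 0 -> 0 < ip x x.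

Let i0l z : ip 0 z = 0.
Proof. by have := ipDZl (-1) 0 0 z; rewrite scaler0 addr0 mulN1r addNr. Qed.
Let iDl x y z : ip (x + y) z = ip x z + ip y z.
Proof. by have := ipDZl 1 x y z; rewrite scale1r mul1r. Qed.
Let iZl a x z : ip (a *: x) z = a * ip x z.
Proof. by have := ipDZl a x 0 z; rewrite addr0 i0l addr0. Qed.
Let iDr x y z : ip z (x + y) = ip z x + ip z y.
Proof. by rewrite ipC iDl rmorphD/= -!ipC. Qed.
Let iZr a x z : ip z (a *: x) = a^* * ip z x.
Proof. by rewrite ipC iZl rmorphM/= -ipC. Qed.
Let i_ge0 x : 0 <= ip x x.
Proof. by have [->|/ip_gt0/ltW//] := eqVneq x 0; rewrite i0l. Qed.

Definition ip_norm x := sqrtC (ip x x).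

Lemma ip_norm_ge0 x : 0 <= ip_norm x. Proof. by rewrite sqrtC_ge0. Qed.
Lemma ip_normE x : ip_norm x ^+ 2 = ip x x. Proof. exact: sqrtCK. Qed.

Lemma ip_norm_eq0 x : ip_norm x = 0 -> x = 0.
Proof.
move=> /eqP; rewrite sqrtC_eq0 => /eqP x0; apply/eqP/negP => /negP /ip_gt0.
by rewrite x0 ltxx.
Qed.

Lemma ip_normZ (l : R[i]) x : ip_norm (l *: x) = `|l| * ip_norm x.
Proof.
apply/eqP; rewrite -(@eqrXn2 _ 2)// ?mulr_ge0 ?ip_norm_ge0// exprMn !ip_normE.
by rewrite iZl iZr mulrA sqr_normc.
Qed.

Lemma ip_cs x y : `|ip x y| <= ip_norm x * ip_norm y.
Proof.
rewrite -(@ler_pXn2r _ 2)// ?nnegrE ?mulr_ge0 ?ip_norm_ge0// exprMn !ip_normE.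
have [->|y0] := eqVneq y 0.
  by rewrite (ipC 0) !i0l rmorph0 normr0 expr0n mulr0.
have yy0 := ip_gt0 y0.
have yyn : ip y y != 0 by rewrite gt_eqF.
have := i_ge0 (ip y y *: x + (- ip x y) *: y).
have byy : (ip y y)^* = ip y y by rewrite -ipC.
rewrite !(iDl, iDr, iZl, iZr) (ipC x y) rmorphN byy.
set d := ip x y; set b := ip y y; set a := ip x x => h.
have {h} : 0 <= b * (a * b - d * d^*).
  by apply: le_trans h _; rewrite le_eqVlt; apply/orP; left; apply/eqP; ring.
by rewrite pmulr_rge0// subr_ge0 normCK.
Qed.

Lemma ip_normD x y : ip_norm (x + y) <= ip_norm x + ip_norm y.
Proof.
rewrite -(@ler_pXn2r _ 2)// ?nnegrE ?addr_ge0 ?ip_norm_ge0//.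
rewrite sqrrD !ip_normE !(iDl, iDr) (ipC x y) -subr_ge0.
have -> : forall a b c d e : R[i],
    a + c *+ 2 + b - (a + d + (e + b)) = c *+ 2 - (d + e) by move=> *; ring.
rewrite subr_ge0.
apply: le_trans (_ : `|ip x y + (ip x y)^*| <= _).
  rewrite real_ler_norm// CrealE rmorphD/= conjCK addrC//.
by rewrite (le_trans (ler_normD _ _))// norm_conjC mulr2n lerD ?ip_cs.
Qed.

End InnerNorm.

Section SequentialCompleteness.
Variables (R : realType) (V : normedModType R[i]).

Lemma seq_complete (F : set_system V) :
  (forall u : nat -> V,
     (forall e : R, 0 < e -> exists N, forall p q, (N <= p)%N -> (N <= q)%N ->
        `|u p - u q| < e%:C%C) ->
     exists l, forall e : R, 0 < e -> exists N, forall p, (N <= p)%N ->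
        `|u p - l| < e%:C%C) ->
  ProperFilter F -> cauchy F -> cvg F.
Proof.
move=> V_complete FF /cauchyP F_cauchy.
have e0 k : 0 < (k.+1%:R^-1 : R)%:C%C by rewrite ltcR invr_gt0.
have /choice[u uF] k : exists x, F (ball x (k.+1%:R^-1 : R)%:C%C).
  by have [x ?] := F_cauchy _ (e0 k); exists x.
have archi (e : R) : 0 < e -> exists N, forall p, (N <= p)%N ->
    p.+1%:R^-1 < e.
  move=> e_gt0; exists (Num.truncn e^-1).+1 => p Np.
  rewrite invf_plt ?posrE//; apply: lt_trans (truncnS_gt _) _.
  by rewrite ltr_nat ltnS.
have [e e_gt0|l ul] := V_complete u.
  have [N hN] := archi (e / 2) (divr_gt0 e_gt0 (ltr0Sn _ _)).
  exists N => p q /hN Np /hN Nq.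
  have [z []] := filter_ex (filterI (uF p) (uF q)).
  rewrite -!ball_normE/= => zp zq.
  rewrite [_ - _](_ : _ = (u p - z) - (u q - z)); last by rewrite opprB addrA subrK.
  rewrite (le_lt_trans (ler_normB _ _))// (lt_trans (ltrD zp zq))//.
  by rewrite -rmorphD/= ltcR (splitr e) ltrD.
apply/cvg_ex; exists l; apply/cvgrPdist_lt => eps eps_gt0.
have -> : eps = (complex.Re eps)%:C%C by rewrite RRe_real// gtr0_real.
set e := complex.Re eps.
have e_gt0 : 0 < e by rewrite -ltcR RRe_real// gtr0_real.
have e2_gt0 := divr_gt0 e_gt0 (ltr0Sn R 1).
have [N hN] := archi _ e2_gt0.
have [M hM] := ul _ e2_gt0.
apply: filterS (uF (maxn N M)) => z.
rewrite -ball_normE/= => uz.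
rewrite [_ - _](_ : _ = (u (maxn N M) - z) - (u (maxn N M) - l)); last first.
  by rewrite opprB [RHS]addrC addrA subrK.
rewrite (le_lt_trans (ler_normB _ _))//.
rewrite [e]splitr rmorphD/= ltrD ?hM ?leq_maxr// (lt_trans uz)// ltcR.
by rewrite hN// leq_maxl.
Qed.

End SequentialCompleteness.

(* The inner product is linear in its first argument. *)
HB.mixin Record NormedModule_isHilbert (R : realType) H
    & CompleteNormedModule R[i] H := {
  inner : H -> H -> R[i];
  innerDZl : forall (a : R[i]) (x y z : H),
    inner (a *: x + y) z = a * inner x z + inner y z;
  innerC : forall x y : H, inner y x = (inner x y)^*;
  inner_norm : forall x : H, inner x x = `|x| ^+ 2
}.

#[short(type="hilbertType")]
HB.structure Definition Hilbert (R : realType) :=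
  {H of CompleteNormedModule R[i] H & NormedModule_isHilbert R H}.

HB.factory Record Lmodule_isHilbert (R : realType) H & GRing.Lmodule R[i] H := {
  inner : H -> H -> R[i];
  innerDZl : forall (a : R[i]) (x y z : H),
    inner (a *: x + y) z = a * inner x z + inner y z;
  innerC : forall x y : H, inner y x = (inner x y)^*;
  inner_gt0 : forall x : H, x != 0 -> 0 < inner x x;
  inner_complete : forall u : nat -> H,
    (forall e : R, 0 < e -> exists N, forall p q, (N <= p)%N -> (N <= q)%N ->
       inner (u p - u q) (u p - u q) < e%:C%C) ->
    exists l, forall e : R, 0 < e -> exists N, forall p, (N <= p)%N ->
       inner (u p - l) (u p - l) < e%:C%C
}.

HB.builders Context R H & Lmodule_isHilbert R H.

HB.instance Definition _ := @Lmodule_isNormed.Build R[i] H (ip_norm inner)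
  (ip_normD innerDZl innerC inner_gt0)
  (ip_normZ innerDZl innerC inner_gt0)
  (@ip_norm_eq0 _ _ _ inner_gt0).

Let normE (x : H) : `|x| ^+ 2 = inner x x.
Proof. exact: ip_normE. Qed.

Let normlt (x : H) (e : R) : 0 < e -> (`|x| < e%:C%C) = (inner x x < (e ^+ 2)%:C%C).
Proof.
move=> e0; rewrite -normE rmorphXn/= ltr_pXn2r// nnegrE//.
by rewrite lecR ltW.
Qed.

Let complete (F : set_system H) : ProperFilter F -> cauchy F -> cvg F.
Proof.
apply: seq_complete => u u_cauchy.
have [e e0|l ul] := inner_complete (u := u).
  have se0 : 0 < Num.sqrt e by rewrite sqrtr_gt0.
  have [N hN] := u_cauchy _ se0; exists N => p q Np Nq.
  by have := hN _ _ Np Nq; rewrite normlt// sqr_sqrtr// ltW.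
exists l => e e0; have [N hN] := ul _ (exprn_gt0 2 e0).
by exists N => p /hN; rewrite normlt.
Qed.

HB.instance Definition _ := Uniform_isComplete.Build H complete.

HB.instance Definition _ := @NormedModule_isHilbert.Build R H
  inner innerDZl innerC (fun x => esym (normE x)).

HB.end.

Section HilbertTheory.
Variables (R : realType) (H : hilbertType R).
Implicit Types (x y z : H) (a : R[i]).

Lemma innerDl x y z : inner (x + y) z = inner x z + inner y z.
Proof. by have := innerDZl 1 x y z; rewrite scale1r mul1r. Qed.

Lemma inner0l z : inner 0 z = 0 :> R[i].
Proof. by apply: (addrI (inner 0 z)); rewrite -innerDl !addr0. Qed.

Lemma innerZl a x z : inner (a *: x) z = a * inner x z.
Proof. by have := innerDZl a x 0 z; rewrite addr0 inner0l addr0. Qed.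

Lemma innerDr x y z : inner z (x + y) = inner z x + inner z y.
Proof. by rewrite innerC innerDl rmorphD/= -!innerC. Qed.

Lemma innerZr a x z : inner z (a *: x) = a^* * inner z x.
Proof. by rewrite innerC innerZl rmorphM/= -innerC. Qed.

Lemma inner0r z : inner z 0 = 0 :> R[i].
Proof. by rewrite innerC inner0l rmorph0. Qed.

Lemma inner_ge0 x : 0 <= inner x x.
Proof. by rewrite inner_norm exprn_ge0. Qed.

Lemma inner_gt0 x : x != 0 -> 0 < inner x x.
Proof. by move=> x0; rewrite inner_norm exprn_gt0// normr_gt0. Qed.

Lemma norm_lt_inner x (e : R) :
  0 < e -> (`|x| < e%:C%C) = (inner x x < (e ^+ 2)%:C%C).
Proof.
by move=> e0; rewrite inner_norm rmorphXn/= ltr_pXn2r// nnegrE// lecR ltW.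
Qed.

Lemma inner_complete (u : nat -> H) :
  (forall e : R, 0 < e -> exists N, forall p q, (N <= p)%N -> (N <= q)%N ->
     inner (u p - u q) (u p - u q) < e%:C%C) ->
  exists l, u @ \oo --> l /\
    forall e : R, 0 < e -> exists N, forall p, (N <= p)%N ->
      inner (u p - l) (u p - l) < e%:C%C.
Proof.
move=> u_cauchy.
have : cvg (u @ \oo).
  apply/cauchy_cvgP/cauchy_exP => eps eps0.
  have -> : eps = (complex.Re eps)%:C%C by rewrite RRe_real// gtr0_real.
  have e0 : 0 < complex.Re eps by rewrite -ltcR RRe_real// gtr0_real.
  have [N hN] := u_cauchy _ (exprn_gt0 2 e0); exists (u N), N => // p /= Np.
  by rewrite -ball_normE/= norm_lt_inner// hN.
move=> /cvg_ex[l ul]; exists l; split=> // e e0.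
have se0 : 0 < Num.sqrt e by rewrite sqrtr_gt0.
have /cvgrPdist_lt/(_ (Num.sqrt e)%:C%C) := ul.
rewrite ltcR => /(_ se0)[N _ hN]; exists N => p /hN/=.
by rewrite distrC norm_lt_inner// sqr_sqrtr// ltW.
Qed.

End HilbertTheory.

(* A closed subspace, as a Hilbert space in its own right. *)
Record csubspace (R : realType) (H : hilbertType R) := CSubspace {
  csubspace_set :> set H;
  csubspace_submod : submod_closed [in csubspace_set];
  csubspace_closed : closed csubspace_set
}.

Section Subspace.
Variables (R : realType) (H : hilbertType R) (S : csubspace H).

Definition csubspace_pred : {pred H} := [in csubspace_set S].
HB.instance Definition _ :=
  GRing.isSubmodClosed.Build _ _ csubspace_pred (csubspace_submod S).

Definition subspace_of := {x : H | csubspace_pred x}.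
HB.instance Definition _ := SubChoice.on subspace_of.
HB.instance Definition _ := [SubChoice_isSubLmodule of subspace_of by <:].

Let ip (x y : subspace_of) := inner (val x) (val y).

Let ipDZl a x y z : ip (a *: x + y) z = a * ip x z + ip y z.
Proof. by rewrite /ip linearP innerDZl. Qed.

Let ip_gt0 x : x != 0 -> 0 < ip x x.
Proof.
by move=> x0; apply: inner_gt0; apply: contra_neq x0 => x0; apply/val_inj.
Qed.

Let ip_complete (u : nat -> subspace_of) :
  (forall e : R, 0 < e -> exists N, forall p q, (N <= p)%N -> (N <= q)%N ->
     ip (u p - u q) (u p - u q) < e%:C%C) ->
  exists l, forall e : R, 0 < e -> exists N, forall p, (N <= p)%N ->
     ip (u p - l) (u p - l) < e%:C%C.
Proof.
move=> u_cauchy; have [e e0|l [ul lP]] := @inner_complete R H (val \o u).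
  have [N hN] := u_cauchy _ e0; exists N => p q Np Nq.
  by have := hN _ _ Np Nq; rewrite /ip raddfB.
have Sl : csubspace_pred l.
  rewrite /csubspace_pred inE.
  apply: (closed_cvg _ (@csubspace_closed _ _ S) _ l ul).
  by apply: nearW => k; have := valP (u k); rewrite /csubspace_pred inE.
exists (Sub l Sl) => e e0; have [N hN] := lP _ e0; exists N => p /hN.
by rewrite /ip raddfB.
Qed.

HB.instance Definition _ := @Lmodule_isHilbert.Build R subspace_of ip
  ipDZl (fun x y => innerC (val x) (val y)) ip_gt0 ip_complete.

End Subspace.

(* The orthogonal direct sum of two Hilbert spaces.  It is an alias of the
   product type because the latter carries the sup norm. *)
Definition hsum (R : realType) (H K : hilbertType R) : Type := (H * K)%type.

Section DirectSum.
Variables (R : realType) (H K : hilbertType R).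

HB.instance Definition _ := GRing.Lmodule.copy (hsum H K) (H * K)%type.

Let ip (x y : hsum H K) := inner x.1 y.1 + inner x.2 y.2.

Let ipDZl a x y z : ip (a *: x + y) z = a * ip x z + ip y z.
Proof. by rewrite /ip !innerDZl mulrDr addrACA. Qed.

Let ipC x y : ip y x = (ip x y)^*.
Proof. by rewrite /ip rmorphD/= -!innerC. Qed.

Let ip_gt0 x : x != 0 -> 0 < ip x x.
Proof.
case: x => x y; rewrite /ip/=; have [->|/inner_gt0 x0 _] := eqVneq x 0.
  have [->|/inner_gt0 y0 _] := eqVneq y 0; first by rewrite eqxx.
  by rewrite ltr_wpDl// inner_ge0.
by rewrite ltr_pwDl// inner_ge0.
Qed.

Let ip_complete (u : nat -> hsum H K) :
  (forall e : R, 0 < e -> exists N, forall p q, (N <= p)%N -> (N <= q)%N ->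
     ip (u p - u q) (u p - u q) < e%:C%C) ->
  exists l, forall e : R, 0 < e -> exists N, forall p, (N <= p)%N ->
     ip (u p - l) (u p - l) < e%:C%C.
Proof.
move=> u_cauchy.
have [e e0|l1 [_ l1P]] := @inner_complete R H (fun k => (u k).1).
  have [N hN] := u_cauchy _ e0; exists N => p q Np Nq.
  by apply: le_lt_trans (hN _ _ Np Nq); rewrite lerDl inner_ge0.
have [e e0|l2 [_ l2P]] := @inner_complete R K (fun k => (u k).2).
  have [N hN] := u_cauchy _ e0; exists N => p q Np Nq.
  by apply: le_lt_trans (hN _ _ Np Nq); rewrite lerDr inner_ge0.
exists (l1, l2) => e e0.
have [N1 h1] := l1P _ (divr_gt0 e0 (ltr0Sn _ 1)).
have [N2 h2] := l2P _ (divr_gt0 e0 (ltr0Sn _ 1)).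
exists (maxn N1 N2) => p; rewrite geq_max => /andP[/h1 ? /h2 ?].
by rewrite [e]splitr rmorphD/= ltrD.
Qed.

HB.instance Definition _ := @Lmodule_isHilbert.Build R (hsum H K) ip
  ipDZl ipC ip_gt0 ip_complete.

End DirectSum.

(* The orthogonal direct sum of copies of H indexed by a finite type. *)
Definition hpow (R : realType) (I : finType) (H : hilbertType R) : Type :=
  {ffun I -> H}.

Section Power.
Variables (R : realType) (I : finType) (H : hilbertType R).

HB.instance Definition _ := GRing.Lmodule.copy (hpow I H) {ffun I -> H}.

Let ip (x y : hpow I H) := \sum_i inner (x i) (y i).

Let ipDZl a x y z : ip (a *: x + y) z = a * ip x z + ip y z.
Proof.
rewrite /ip mulr_sumr -big_split/=; apply: eq_bigr => i _.
by rewrite !ffunE innerDZl.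
Qed.

Let ipC x y : ip y x = (ip x y)^*.
Proof. by rewrite /ip rmorph_sum; apply: eq_bigr => i _; rewrite innerC. Qed.

Let ip_ge (x : hpow I H) i : inner (x i) (x i) <= ip x x.
Proof. by rewrite /ip (bigD1 i)//= lerDl sumr_ge0// => j _; rewrite inner_ge0. Qed.

Let ip_gt0 x : x != 0 -> 0 < ip x x.
Proof.
move=> x0; have [i xi0] : exists i, x i != 0.
  apply/existsP; apply: contra_neqT x0 => /existsPn x0.
  by apply/ffunP => i; rewrite ffunE; apply/eqP; rewrite -[_ == _]negbK x0.
exact: lt_le_trans (inner_gt0 xi0) (ip_ge x i).
Qed.

Let ip_complete (u : nat -> hpow I H) :
  (forall e : R, 0 < e -> exists N, forall p q, (N <= p)%N -> (N <= q)%N ->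
     ip (u p - u q) (u p - u q) < e%:C%C) ->
  exists l, forall e : R, 0 < e -> exists N, forall p, (N <= p)%N ->
     ip (u p - l) (u p - l) < e%:C%C.
Proof.
move=> u_cauchy.
have /choice[l lP] i : exists l, forall e : R, 0 < e -> exists N, forall p, (N <= p)%N ->
    inner (u p i - l) (u p i - l) < e%:C%C.
  have [e e0|l [_ lP]] := @inner_complete R H (fun k => u k i); last by exists l.
  have [N hN] := u_cauchy _ e0; exists N => p q Np Nq.
  apply: le_lt_trans (hN _ _ Np Nq).
  by have := ip_ge (u p - u q) i; rewrite !ffunE.
exists [ffun i => l i] => e e0.
pose e' := e / #|I|.+1%:R.
have e'0 : 0 < e' by rewrite divr_gt0.
have /choice[N NP] i : exists N, forall p, (N <= p)%N ->
    inner (u p i - l i) (u p i - l i) < e'%:C%C by exact: lP.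
exists (\max_i N i) => p Np.
apply: (@le_lt_trans _ _ (\sum_(i : I) e'%:C%C)).
  apply: ler_sum => i _; rewrite !ffunE ltW// NP//.
  by apply: leq_trans Np; exact: (leq_bigmax i).
rewrite sumr_const -rmorphMn/= ltcR /e' -mulr_natr mulrAC ltr_pdivrMr//.
by rewrite ltr_pM2l// ltr_nat.
Qed.

HB.instance Definition _ := @Lmodule_isHilbert.Build R (hpow I H) ip
  ipDZl ipC ip_gt0 ip_complete.

End Power.

Definition csum_cvg (R : realType) (z : nat -> R[i]) :=
  cvgn (series (@complex.Re _ \o z)) /\ cvgn (series (@complex.Im _ \o z)).

Definition csum (R : realType) (z : nat -> R[i]) : R[i] :=
  Complex (limn (series (@complex.Re _ \o z))) (limn (series (@complex.Im _ \o z))).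

Section ComplexSeries.
Variable R : realType.
Implicit Types (y z : nat -> R[i]) (a : R[i]).

Lemma csumDZ a y z : csum_cvg y -> csum_cvg z ->
  csum (fun m => a * y m + z m) = a * csum y + csum z.
Proof.
case: a => a b [ry iy] [rz iz].
rewrite /csum.
have -> : @complex.Re _ \o (fun m => Complex a b * y m + z m) =
    a *: (@complex.Re _ \o y) - b *: (@complex.Im _ \o y) + (@complex.Re _ \o z).
  apply/funext => m.
  rewrite -[RHS]/(a * complex.Re (y m) - b * complex.Im (y m) + complex.Re (z m)).
  by rewrite /=; case: (y m); case: (z m).
have -> : @complex.Im _ \o (fun m => Complex a b * y m + z m) =
    a *: (@complex.Im _ \o y) + b *: (@complex.Re _ \o y) + (@complex.Im _ \o z).
  apply/funext => m.
  rewrite -[RHS]/(a * complex.Im (y m) + b * complex.Re (y m) + complex.Im (z m)).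
  by rewrite /=; case: (y m); case: (z m).
have ary := is_cvg_seriesZ (k := a) ry.
have bry := is_cvg_seriesZ (k := b) ry.
have aiy := is_cvg_seriesZ (k := a) iy.
have biy := is_cvg_seriesZ (k := b) iy.
have cr := is_cvg_seriesB ary biy.
have ci := is_cvg_seriesD aiy bry.
rewrite (lim_seriesD cr rz) (lim_seriesD ci iz) (lim_seriesB ary biy)
  (lim_seriesD aiy bry) (lim_seriesZ a ry) (lim_seriesZ b ry)
  (lim_seriesZ a iy) (lim_seriesZ b iy).
exact: erefl.
Qed.

Lemma csum_conj z : csum_cvg z -> csum (fun m => (z m)^*) = (csum z)^*.
Proof.
move=> [rz iz]; rewrite /csum.
have -> : @complex.Re _ \o (fun m => (z m)^*) = @complex.Re _ \o z.
  by apply/funext => m /=; case: (z m).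
have -> : @complex.Im _ \o (fun m => (z m)^*) = - (@complex.Im _ \o z).
  by apply/funext => m; rewrite -[RHS]/(- complex.Im (z m)) /=; case: (z m).
by rewrite lim_seriesN.
Qed.

Lemma csum_single z k : (forall m, m != k -> z m = 0) ->
  csum_cvg z /\ csum z = z k.
Proof.
move=> z0; have single (x : nat -> R) : (forall m, m != k -> x m = 0) ->
    series x @ \oo --> x k.
  move=> x0; apply: cvg_near_cst; exists k.+1 => // N /= kN.
  rewrite /series/= big_mkord (bigD1 (Ordinal kN))//= big1 ?addr0// => i ik.
  exact: x0.
have rz := single (fun m => complex.Re (z m)) (fun m mk => congr1 _ (z0 m mk)).
have iz := single (fun m => complex.Im (z m)) (fun m mk => congr1 _ (z0 m mk)).
split; first by split; apply/cvg_ex; [exists (complex.Re (z k))|exists (complex.Im (z k))].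
by rewrite /csum (cvg_lim _ rz)// (cvg_lim _ iz)//; case: (z k).
Qed.

End ComplexSeries.

(* Words in n letters index the standard basis of the full Fock space over
   C^n, the words of length m giving that of the m-th tensor power; a function
   u from words to H stands for the sum over w of e_w (x) u w. *)
Definition level (R : realType) (n : nat) (H : hilbertType R)
    (u v : seq 'I_n -> H) (m : nat) : R[i] :=
  \sum_(w : m.-tuple 'I_n) inner (u w) (v w).

Definition fock_pred (R : realType) (n : nat) (H : hilbertType R) :
    {pred seq 'I_n -> H} :=
  fun u => `[< csum_cvg (level u u) >].

Definition fock (R : realType) (n : nat) (H : hilbertType R) :=
  {u : seq 'I_n -> H | @fock_pred R n H u}.

Section FockSpace.
Variables (R : realType) (n : nat) (H : hilbertType R).
Implicit Types (x y : H) (u v : seq 'I_n -> H).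

Definition sqn x : R := complex.Re (inner x x).

Lemma sqnE x : inner x x = (sqn x)%:C%C.
Proof. by rewrite RRe_real// ger0_real// inner_ge0. Qed.

Lemma sqn_ge0 x : 0 <= sqn x.
Proof. by rewrite -lecR -sqnE inner_ge0. Qed.

Lemma sqnN x : sqn (- x) = sqn x.
Proof.
apply/complexI; rewrite -!sqnE -scaleN1r innerZl innerZr.
by rewrite rmorphN1 mulN1r mulN1r opprK.
Qed.

Lemma sqnD x y : sqn (x + y) + sqn (x - y) = 2 * sqn x + 2 * sqn y.
Proof.
have inNl (u v : H) : inner (- u) v = - inner u v :> R[i].
  by rewrite -scaleN1r innerZl mulN1r.
have inNr (u v : H) : inner u (- v) = - inner u v :> R[i].
  by rewrite -scaleN1r innerZr rmorphN1 mulN1r.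
rewrite /sqn !(innerDl, innerDr) !inNr !inNl opprK.
rewrite !raddfD/= !raddfN/=; ring.
Qed.

Lemma sqnD_le x y : sqn (x + y) <= 2 * sqn x + 2 * sqn y.
Proof. by rewrite -sqnD lerDl sqn_ge0. Qed.

Lemma sqnZ a x : sqn (a *: x) = complex.Re (`|a| ^+ 2) * sqn x.
Proof.
set r := complex.Re _.
have er : r%:C%C = `|a| ^+ 2 by rewrite RRe_real// realX// normr_real.
by apply/complexI; rewrite rmorphM/= -!sqnE innerZl innerZr mulrA -normCK -er.
Qed.

Lemma norm_inner_le x y : `|inner x y| <= (sqn x + sqn y)%:C%C.
Proof.
have h := @ip_cs R H (@inner R H) (@innerDZl R H) (@innerC R H) (@inner_gt0 R H) x y.
refine (le_trans h _).
have normE z : ip_norm inner z = (Num.sqrt (sqn z))%:C%C.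
  have i0 : 0 <= ip_norm inner z by rewrite sqrtC_ge0 inner_ge0.
  apply/eqP; rewrite -(@eqrXn2 _ 2)// ?lecR ?sqrtr_ge0//.
  by rewrite ip_normE -rmorphXn/= sqr_sqrtr ?sqn_ge0// -sqnE.
rewrite !normE -rmorphM/= lecR.
rewrite -[in leRHS](sqr_sqrtr (sqn_ge0 x)) -[in leRHS](sqr_sqrtr (sqn_ge0 y)).
have := sqrtr_ge0 (sqn x); have := sqrtr_ge0 (sqn y).
by move: (Num.sqrt _) (Num.sqrt _) => a b a0 b0; nra.
Qed.

Definition plevel u (N : nat) : R :=
  \sum_(m < N) \sum_(w : m.-tuple 'I_n) sqn (u w).

Lemma plevelE u : series (@complex.Re _ \o level u u) = plevel u.
Proof.
rewrite seriesEord; apply/funext => N /=; apply: eq_bigr => m _.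
by rewrite /level/= raddf_sum.
Qed.

Lemma level_Im u : @complex.Im _ \o level u u = 0.
Proof.
apply/funext => m /=; rewrite /level raddf_sum big1//= => w _.
by rewrite sqnE.
Qed.

Lemma plevel_nd u : {homo plevel u : N M / (N <= M)%N >-> N <= M}.
Proof.
rewrite -plevelE => N M NM; apply: nondecreasing_series NM => m _ _ /=.
by rewrite /level raddf_sum sumr_ge0// => w _; exact: sqn_ge0.
Qed.

Lemma fockP u : reflect (exists M, forall N, plevel u N <= M) (fock_pred u).
Proof.
apply: (iffP (asboolP _)) => [[cu _]|[M uM]].
  exists (limn (plevel u)) => N; apply: nondecreasing_cvgn_le.
    exact: plevel_nd.
  by rewrite -plevelE.
split; last first.
  rewrite level_Im (_ : series _ = cst 0); first exact: is_cvg_cst.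
  by apply/funext => N; rewrite /series/= big1.
rewrite plevelE; apply: nondecreasing_is_cvgn; first exact: plevel_nd.
by exists M => _ [N _ <-].
Qed.

Lemma plevelDZ a u v N : plevel (a *: u + v) N <=
  2 * complex.Re (`|a| ^+ 2) * plevel u N + 2 * plevel v N.
Proof.
rewrite /plevel !mulr_sumr -big_split/=; apply: ler_sum => m _.
rewrite !mulr_sumr -big_split/=; apply: ler_sum => w _.
by apply: le_trans (sqnD_le _ _) _; rewrite sqnZ mulrA.
Qed.

Lemma plevelD u v N : plevel (u + v) N <= 2 * plevel u N + 2 * plevel v N.
Proof.
rewrite /plevel !mulr_sumr -big_split/=; apply: ler_sum => m _.
by rewrite !mulr_sumr -big_split/=; apply: ler_sum => w _; exact: sqnD_le.
Qed.

Lemma Renorm2_ge0 a : 0 <= complex.Re (`|a : R[i]| ^+ 2).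
Proof. by rewrite -lecR RRe_real ?exprn_ge0// realX// normr_real. Qed.

Lemma fock_submod_closed : submod_closed (@fock_pred R n H).
Proof.
split=> [|a u v /fockP[M uM] /fockP[K vK]]; apply/fockP.
  exists 0 => N; rewrite /plevel big1// => m _; rewrite big1// => w _.
  by rewrite /sqn -[0 _]/0 inner0l.
exists (2 * complex.Re (`|a| ^+ 2) * M + 2 * K) => N.
apply: le_trans (plevelDZ _ _ _ _) _.
by rewrite lerD// ler_wpM2l// ?mulr_ge0// Renorm2_ge0.
Qed.

HB.instance Definition _ :=
  GRing.isSubmodClosed.Build _ _ (@fock_pred R n H) fock_submod_closed.
HB.instance Definition _ := SubChoice.on (fock n H).
HB.instance Definition _ := [SubChoice_isSubLmodule of fock n H by <:].

Lemma level_cvg (u v : fock n H) : csum_cvg (level (val u) (val v)).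
Proof.
have [/fockP[M uM] /fockP[K vK]] := (valP u, valP v).
suff Rcvg (f : R[i] -> R) : (forall z, `|f z|%:C%C <= `|z|) ->
    cvgn (series (f \o level (val u) (val v))).
  split; apply: Rcvg => z; first exact: normc_ge_Re.
  by rewrite normc_def lecR -sqrtr_sqr ler_wsqrtr// lerDr sqr_ge0.
move=> fle; apply: normed_cvg.
pose g m := \sum_(w : m.-tuple 'I_n) (sqn (val u w) + sqn (val v w)).
have g0 m : 0 <= g m by rewrite sumr_ge0// => w _; rewrite addr_ge0// sqn_ge0.
apply: (@series_le_cvg _ _ g) => // [m|m|]; first exact: normr_ge0.
  rewrite -lecR; apply: le_trans (fle _) _.
  apply: le_trans (ler_norm_sum _ _ _) _; rewrite rmorph_sum.
  by apply: ler_sum => w _; exact: norm_inner_le.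
apply: nondecreasing_is_cvgn.
  by move=> N N' NN'; apply: nondecreasing_series NN' => *; exact: g0.
exists (M + K) => _ [N _ <-]; rewrite seriesEord/=.
apply: le_trans (lerD (uM N) (vK N)).
rewrite /plevel -big_split/= ler_sum// => m _.
by rewrite -big_split.
Qed.

Let ip (u v : fock n H) := csum (level (val u) (val v)).

Lemma levelDZl a u v u' m :
  level (a *: u + v) u' m = a * level u u' m + level v u' m.
Proof.
rewrite /level mulr_sumr -big_split/=; apply: eq_bigr => w _.
by rewrite -innerDZl.
Qed.

Let ipDZl a (x y z : fock n H) : ip (a *: x + y) z = a * ip x z + ip y z.
Proof.
rewrite /ip -csumDZ; [congr csum|exact: level_cvg..].
by apply/funext => m; rewrite linearP levelDZl.
Qed.

Let ipC (x y : fock n H) : ip y x = (ip x y)^*.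
Proof.
rewrite /ip -csum_conj; last exact: level_cvg.
congr csum; apply/funext => m.
by rewrite /level rmorph_sum; apply: eq_bigr => w _; rewrite innerC.
Qed.

Let ipE (u : fock n H) : ip u u = (limn (plevel (val u)))%:C%C.
Proof.
rewrite /ip /csum plevelE level_Im; congr Complex.
rewrite (_ : series _ = cst 0); first exact: lim_cst.
by apply/funext => N; rewrite /series/= big1.
Qed.

Let plevel_lim (u : fock n H) N : plevel (val u) N <= limn (plevel (val u)).
Proof.
apply: nondecreasing_cvgn_le; first exact: plevel_nd.
by rewrite -plevelE; have [] := level_cvg u u.
Qed.

Lemma plevel_ge u (w : seq 'I_n) N : (size w < N)%N -> sqn (u w) <= plevel u N.
Proof.
move=> wN; rewrite /plevel (bigD1 (Ordinal wN))//= (bigD1 (in_tuple w))//=.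
rewrite -addrA lerDl addr_ge0// sumr_ge0// => i _; rewrite ?sqn_ge0//.
by rewrite sumr_ge0// => ? _; rewrite sqn_ge0.
Qed.

Let sqn_lim (u : fock n H) w : sqn (val u w) <= limn (plevel (val u)).
Proof. exact: le_trans (plevel_ge _ (ltnSn (size w))) (plevel_lim _ _). Qed.

Let ip_gt0 (u : fock n H) : u != 0 -> 0 < ip u u.
Proof.
move=> u0; have /existsNP[w /eqP uw0] : ~ forall w, val u w = 0.
  by move=> uw0; move/eqP: u0; apply; apply/val_inj/funext => w; rewrite uw0.
rewrite ipE ltcR; apply: lt_le_trans (sqn_lim u w).
by rewrite -ltcR -sqnE inner_gt0.
Qed.

Let ip_complete (u : nat -> fock n H) :
  (forall e : R, 0 < e -> exists N, forall p q, (N <= p)%N -> (N <= q)%N ->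
     ip (u p - u q) (u p - u q) < e%:C%C) ->
  exists l, forall e : R, 0 < e -> exists N, forall p, (N <= p)%N ->
     ip (u p - l) (u p - l) < e%:C%C.
Proof.
move=> u_cauchy.
have /choice[l lP] w : exists l, forall e : R, 0 < e -> exists N, forall p, (N <= p)%N ->
    sqn (val (u p) w - l) < e.
  have [e e0|l [_ lP]] := @inner_complete R H (fun k => val (u k) w).
    have [N hN] := u_cauchy _ e0; exists N => p q Np Nq.
    apply: le_lt_trans (hN _ _ Np Nq).
    by rewrite ipE sqnE lecR (_ : _ - _ = val (u p - u q) w) ?sqn_lim// raddfB.
  exists l => e e0; have [N hN] := lP _ e0; exists N => p /hN.
  by rewrite sqnE ltcR.
have lim0 M (e : R) : 0 < e -> exists N, forall p, (N <= p)%N ->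
    plevel (val (u p) - l) M < e.
  move=> e0.
  have : (plevel (val (u p) - l) M) @[p --> \oo] --> (0 : R).
    rewrite [X in _ --> X](_ : 0 = \sum_(m < M) \sum_(w : m.-tuple 'I_n) (0:R)).
      apply: cvg_big => [|m _]; first exact: add_continuous.
      apply: cvg_big => [|w _]; first exact: add_continuous.
      apply/cvgrPdist_lt => d d0; have [N hN] := lP w _ d0.
      exists N => // p /hN /=; rewrite sub0r normrN ger0_norm//.
      exact: sqn_ge0.
    by rewrite big1// => m _; rewrite big1.
  move=> /cvgrPdist_lt/(_ _ e0)[N _ hN]; exists N => p /hN /=.
  by rewrite sub0r normrN; apply: le_lt_trans; exact: ler_norm.
have key (e : R) : 0 < e -> exists N, forall p, (N <= p)%N ->
    forall M, plevel (val (u p) - l) M <= e.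
  move=> e0; have e4 : 0 < e / 4 by rewrite divr_gt0.
  have [N hN] := u_cauchy _ e4; exists N => p Np M.
  have [K hK] := lim0 M _ e4.
  pose q := maxn N K.
  have := hN _ _ Np (leq_maxl N K); rewrite ipE ltcR => /ltW hpq.
  have := hK _ (leq_maxr N K) => /ltW hq.
  have := plevelD (val (u p - u q)) (val (u q) - l) M.
  rewrite raddfB/= addrA subrK => /le_trans; apply.
  have := le_trans (plevel_lim (u p - u q) M) hpq; rewrite raddfB/= => hpq'.
  rewrite [leRHS](_ : e = 2 * (e / 4) + 2 * (e / 4)); last by field.
  by rewrite lerD// ler_pM2l.
have fl : fock_pred l.
  have [N hN] := key 1 ltr01.
  have ulP : fock_pred (val (u N) - l).
    by apply/fockP; exists 1 => M; exact: hN.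
  have -> : l = val (u N) - (val (u N) - l) by rewrite opprB addrCA subrr addr0.
  exact: (rpredB (valP (u N)) ulP).
exists (Sub l fl) => e e0.
have [N hN] := key _ (divr_gt0 e0 (ltr0Sn _ 1)); exists N => p Np.
rewrite ipE ltcR raddfB/=; apply: (@le_lt_trans _ _ (e / 2)); last first.
  by rewrite ltr_pdivrMr// ltr_pMr// ltr1n.
apply: limr_le; last by apply: nearW => M; exact: hN.
by have [] := level_cvg (u p - Sub l fl) (u p - Sub l fl); rewrite plevelE raddfB.
Qed.

HB.instance Definition _ := @Lmodule_isHilbert.Build R (fock n H) ip
  ipDZl ipC ip_gt0 ip_complete.

End FockSpace.

Definition subspace_incl (R : realType) (H : hilbertType R) (S : csubspace H)
    (x : subspace_of S) : H := val x.

(* The corestriction to S of an H-valued map; it sends the vectors outside S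
   to 0. *)
Definition corestr (R : realType) (H : hilbertType R) (S : csubspace H)
    (x : H) : subspace_of S := insubd (0 : subspace_of S) x.

Section Operators.
Variables (R : realType) (H K : hilbertType R).

Definition contractive_op (C : H -> K) := forall x, `|C x| <= `|x|.

Definition unitary_op (U : H -> K) :=
  (forall x y, inner (U x) (U y) = inner x y) /\ range U = setT.

(* Definite description; adjoints and positive square roots are unique when
   they exist. *)
Definition the_linear (P : set {linear H -> K}) : {linear H -> K} :=
  if pselect (exists f, P f) is left h then projT1 (cid h) else \0.

(* Used for bijective F only. *)
Definition op_inv (F : H -> K) : K -> H := 'pinv_(fun=> 0) setT F.

End Operators.

Definition adj (R : realType) (H K : hilbertType R) (C : H -> K) :
    {linear K -> H} :=
  the_linear [set C' | forall x y, inner (C x) y = inner x (C' y)].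

Definition positive_op (R : realType) (H : hilbertType R) (D : H -> H) :=
  continuous D /\ forall x, 0 <= inner (D x) x.

(* The defect operator (I - C^* C)^(1/2); that of C^* is [defect (adj C)]. *)
Definition defect (R : realType) (H K : hilbertType R) (C : H -> K) :
    {linear H -> H} :=
  the_linear [set D | positive_op D /\ forall x, D (D x) = x - adj C (C x)].

Lemma closure_range_submod (R : realType) (H K : hilbertType R)
  (f : {linear H -> K}) : submod_closed [in closure (range f)].
Proof.
split=> [|a x y]; rewrite !inE.
  by apply: subset_closure; exists 0; rewrite ?raddf0.
move=> fx fy B.
have : (fun z : K * K => a *: z.1 + z.2) z @[z --> (x, y)] --> a *: x + y.
  by apply: cvgD; [apply: cvgZr; exact: cvg_fst|exact: cvg_snd].
move=> /[apply] -[[X Y] [/= nX nY] XYB].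
have [_ [[x' _ <-] Xx']] := fx _ nX.
have [_ [[y' _ <-] Yy']] := fy _ nY.
exists (a *: f x' + f y'); split; last exact: (XYB (f x', f y')).
by exists (a *: x' + y'); rewrite ?linearP.
Qed.

Definition defect_subspace (R : realType) (H K : hilbertType R) (C : H -> K) :
    csubspace H :=
  CSubspace (closure_range_submod (defect C)) (@closed_closure _ _).

Notation defect_space C := (subspace_of (defect_subspace C)).

Lemma defect_in (R : realType) (H K : hilbertType R) (C : H -> K) x :
  csubspace_pred (defect_subspace C) (defect C x).
Proof. by rewrite /csubspace_pred inE; apply: subset_closure; exists x. Qed.

Definition defect_to (R : realType) (H K : hilbertType R) (C : H -> K) (x : H) :
    defect_space C := Sub (defect C x) (defect_in C x).

(* The 2x2 operator matrix [a, b; c, d]. *)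
Definition opmx (R : realType) (H1 H2 K1 K2 : hilbertType R)
    (a : H1 -> K1) (b : H2 -> K1) (c : H1 -> K2) (d : H2 -> K2)
    (x : hsum H1 H2) : hsum K1 K2 :=
  (a x.1 + b x.2, c x.1 + d x.2).

(* The Julia-Halmos matrix [L^*, D_L; D_(L^* ), - L]; its last entry makes sense
   because L maps D_L into D_(L^* ). *)
Definition julia (R : realType) (H K : hilbertType R) (L : H -> K) :
    hsum K (defect_space L) -> hsum H (defect_space (adj L)) :=
  opmx (adj L) (defect L \o @subspace_incl R H (defect_subspace L))
    (defect_to (adj L))
    (fun y => - corestr (defect_subspace (adj L)) (L (subspace_incl y))).

Definition row_op (R : realType) (n : nat) (H K : hilbertType R)
    (T : 'I_n -> H -> K) (h : hpow 'I_n H) : K := \sum_j T j (h j).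

Definition hpow_split (R : realType) (I : finType) (H K : hilbertType R)
    (h : hpow I (hsum H K)) : hsum (hpow I H) (hpow I K) :=
  ([ffun j => (h j).1], [ffun j => (h j).2]).

(* The element of the Fock space with the given coefficients, 0 if they are not
   square summable. *)
Definition fock_of (R : realType) (n : nat) (H : hilbertType R)
    (u : seq 'I_n -> H) : fock n H := insubd (0 : fock n H) u.

Section FockOf.
Variables (R : realType) (n : nat).

Lemma fock_ofE (H : hilbertType R) (u : seq 'I_n -> H) :
  fock_pred u -> val (fock_of u) = u.
Proof. by move=> fu; rewrite insubdK. Qed.

Lemma fock_pred_le (H K : hilbertType R) (u : seq 'I_n -> H)
    (v : seq 'I_n -> K) (M : R) :
  0 <= M -> (forall w, sqn (v w) <= M * sqn (u w)) ->
  fock_pred u -> fock_pred v.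
Proof.
move=> M0 vu /fockP[B uB]; apply/fockP; exists (M * B) => N.
apply: le_trans (_ : M * plevel u N <= _); last by rewrite ler_wpM2l.
rewrite /plevel mulr_sumr; apply: ler_sum => m _.
by rewrite mulr_sumr; apply: ler_sum => w _.
Qed.

End FockOf.

(* I_Gamma (x) f *)
Definition fock_map (R : realType) (n : nat) (H K : hilbertType R) (f : H -> K)
    (u : fock n H) : fock n K := fock_of (fun w => f (val u w)).

Lemma fock_mapE (R : realType) (n : nat) (H K : hilbertType R) (f : H -> K)
    (M : R) (u : fock n H) :
  (forall x, `|f x| <= M%:C%C * `|x|) ->
  val (fock_map f u) = (fun w => f (val u w)).
Proof.
move=> fM; apply/fock_ofE/fock_pred_le/(valP u); first exact: sqr_ge0 M.
move=> w; rewrite -lecR rmorphM/= rmorphXn/= -!sqnE !inner_norm -exprMn.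
rewrite ler_pXn2r// nnegrE ?normr_ge0// (le_trans _ (fM _))//.
Qed.

Definition fock_split (R : realType) (n : nat) (H K : hilbertType R)
    (u : fock n (hsum H K)) : hsum (fock n H) (fock n K) :=
  (fock_map (fun x : hsum H K => x.1) u, fock_map (fun x : hsum H K => x.2) u).

Definition fock_join (R : realType) (n : nat) (H K : hilbertType R)
    (u : hsum (fock n H) (fock n K)) : fock n (hsum H K) :=
  fock_of (fun w => (val u.1 w, val u.2 w) : hsum H K).

Lemma fock_joinE (R : realType) (n : nat) (H K : hilbertType R)
    (u : hsum (fock n H) (fock n K)) :
  val (fock_join u) = (fun w => (val u.1 w, val u.2 w) : hsum H K).
Proof.
apply: fock_ofE; have [/fockP[M uM] /fockP[N uN]] := (valP u.1, valP u.2).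
apply/fockP; exists (M + N) => k; apply: le_trans (lerD (uM k) (uN k)).
rewrite /plevel -big_split/=; apply: ler_sum => m _; rewrite -big_split/=.
by apply: ler_sum => w _; rewrite /sqn -raddfD.
Qed.

Definition fock_pow (R : realType) (n : nat) (I : finType) (H : hilbertType R)
    (u : fock n (hpow I H)) : hpow I (fock n H) :=
  [ffun j => fock_map (fun h : hpow I H => h j) u].

(* R_j (x) I: e_w (x) h is sent to e_(wj) (x) h *)
Definition rcreation (R : realType) (n : nat) (H : hilbertType R) (j : 'I_n)
    (u : fock n H) : fock n H :=
  fock_of (fun w => if w is i :: w' then
    if last i w' == j then val u (belast i w') else 0 else 0).

Lemma rcreationE (R : realType) (n : nat) (H : hilbertType R) (j : 'I_n)
    (u : fock n H) :
  val (rcreation j u) = (fun w => if w is i :: w' then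
    if last i w' == j then val u (belast i w') else 0 else 0).
Proof.
set rc := RHS.
have rc_rcons w : rc (rcons w j) = val u w.
  by case: w => [|i w]; rewrite /rc/= ?eqxx// last_rcons belast_rcons eqxx.
have rc_level m : \sum_(w : m.+1.-tuple 'I_n) sqn (rc w) =
    \sum_(w : m.-tuple 'I_n) sqn (val u w).
  rewrite (bigID (fun w : m.+1.-tuple 'I_n => last j w == j))/=.
  rewrite [X in _ + X]big1 ?addr0 => [|w]; last first.
    by case/tupleP: w => i w/= /negbTE wj; rewrite /rc/= wj /sqn inner0l.
  rewrite (reindex_onto (fun t : m.-tuple 'I_n => [tuple of rcons t j])
    (fun w => [tuple of belast (thead w) (behead w)])) /=; last first.
    move=> w wj; apply/val_inj; case/tupleP: w wj => i w /= /eqP wj.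
    by rewrite theadE -[in X in rcons _ X]wj -lastI.
  apply: eq_big => [t|t _]; last by rewrite rc_rcons.
  rewrite last_rcons eqxx/=; apply/eqP/val_inj => /=.
  rewrite /thead (tnth_nth j)/=; case: (tval t) => //= i s.
  by rewrite belast_rcons.
apply: fock_ofE; have /fockP[M uM] := valP u; apply/fockP; exists M => N.
apply: le_trans (uM N); case: N => [|N]; first by rewrite /plevel !big_ord0.
rewrite {1}/plevel big_ord_recl big1 ?add0r => [|w _]; last first.
  by rewrite tuple0 /sqn inner0l.
rewrite {1}/plevel big_ord_recr/= ler_wpDr//.
  by rewrite sumr_ge0// => w _; exact: sqn_ge0.
by apply: ler_sum => m _; rewrite -rc_level.
Qed.


(* The complex numbers as a Hilbert space; [fock n (scalars R)] is Gamma. *)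
Definition scalars (R : realType) : Type := R[i].

Section Scalars.
Variable R : realType.

HB.instance Definition _ := GRing.Lmodule.copy (scalars R) R[i]^o.

Let ip (x y : scalars R) : R[i] := (x : R[i]) * (y : R[i])^*.

Let ipDZl (a : R[i]) (x y z : scalars R) :
  ip (a *: x + y) z = a * ip x z + ip y z.
Proof. by rewrite /ip mulrDl mulrA. Qed.

Let ipC x y : ip y x = (ip x y)^*.
Proof. by rewrite /ip rmorphM/= conjCK mulrC. Qed.

Let ip_gt0 (x : scalars R) : x != 0 -> 0 < ip x x.
Proof. by move=> x0; rewrite /ip -normCK exprn_gt0// normr_gt0. Qed.

Let real_complete (x : nat -> R) :
  (forall e : R, 0 < e -> exists N, forall p q, (N <= p)%N -> (N <= q)%N ->
     `|x p - x q| < e) ->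
  exists l, forall e : R, 0 < e -> exists N, forall p, (N <= p)%N ->
     `|x p - l| < e.
Proof.
move=> x_cauchy; have : cvg (x @ \oo).
  apply/cauchy_cvgP/cauchy_exP => e e0.
  have [N hN] := x_cauchy _ e0; exists (x N), N => // p /= Np.
  by rewrite -ball_normE/= hN.
move=> /cvg_ex[l xl]; exists l => e e0.
have /cvgrPdist_lt/(_ _ e0)[N _ hN] := xl.
by exists N => p /hN/=; rewrite distrC.
Qed.

Let ip_complete (u : nat -> scalars R) :
  (forall e : R, 0 < e -> exists N, forall p q, (N <= p)%N -> (N <= q)%N ->
     ip (u p - u q) (u p - u q) < e%:C%C) ->
  exists l, forall e : R, 0 < e -> exists N, forall p, (N <= p)%N ->
     ip (u p - l) (u p - l) < e%:C%C.
Proof.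
move=> u_cauchy.
have ipE (x y : scalars R) : ip (x - y) (x - y) =
    ((complex.Re x - complex.Re y) ^+ 2 +
     (complex.Im x - complex.Im y) ^+ 2)%:C%C.
  by rewrite /ip -normCK -add_Re2_Im2; case: x; case: y.
have sq_lt (x e : R) : 0 < e -> (`|x| < e) = (x ^+ 2 < e ^+ 2).
  by move=> e0; rewrite -(real_normK (num_real x)) ltr_pXn2r// nnegrE// ltW.
have [e e0|l1 l1P] := real_complete (x := fun k => complex.Re (u k)).
  have [N hN] := u_cauchy _ (exprn_gt0 2 e0); exists N => p q Np Nq.
  have := hN _ _ Np Nq; rewrite ipE ltcR sq_lt//; apply: le_lt_trans.
  by rewrite lerDl sqr_ge0.
have [e e0|l2 l2P] := real_complete (x := fun k => complex.Im (u k)).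
  have [N hN] := u_cauchy _ (exprn_gt0 2 e0); exists N => p q Np Nq.
  have := hN _ _ Np Nq; rewrite ipE ltcR sq_lt//; apply: le_lt_trans.
  by rewrite lerDr sqr_ge0.
exists (Complex l1 l2 : scalars R) => e e0.
have se0 : 0 < Num.sqrt (e / 2) by rewrite sqrtr_gt0 divr_gt0.
have [N1 h1] := l1P _ se0; have [N2 h2] := l2P _ se0.
exists (maxn N1 N2) => p; rewrite geq_max => /andP[/h1 + /h2].
rewrite !sq_lt// sqr_sqrtr ?divr_ge0 ?ltW// => hp1 hp2.
by rewrite ipE ltcR (splitr e) ltrD.
Qed.

HB.instance Definition _ := @Lmodule_isHilbert.Build R (scalars R) ip
  ipDZl ipC ip_gt0 ip_complete.

End Scalars.

(* [fock n H] is the Hilbert tensor product of Gamma and H. *)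
Section FockTensor.
Variables (R : realType) (n : nat).
Implicit Types (H K : hilbertType R) (g : fock n (scalars R)).

Definition fock_tensor H g (h : H) : fock n H :=
  fock_of (fun w => (val g w : R[i]) *: h).

Lemma fock_tensorE H g (h : H) :
  val (fock_tensor g h) = fun w => (val g w : R[i]) *: h.
Proof.
apply: fock_ofE; apply: (fock_pred_le (sqn_ge0 h)) (valP g) => w.
rewrite -lecR rmorphM/= -!sqnE mulrC innerZl innerZr mulrA.
exact: lexx.
Qed.

Lemma inner_fock H (u v : fock n H) : inner u v = csum (level (val u) (val v)).
Proof. by []. Qed.

Lemma inner_fock_tensor H g1 g2 (h1 h2 : H) :
  inner (fock_tensor g1 h1) (fock_tensor g2 h2) = inner g1 g2 * inner h1 h2.
Proof.
have [cz z0] := @csum_single R (fun=> 0) 0 (fun _ _ => erefl).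
rewrite !inner_fock !fock_tensorE [RHS]mulrC -[RHS]addr0 -z0 -csumDZ//; last first.
  exact: level_cvg.
congr csum; apply/funext => m; rewrite addr0 /level mulr_sumr.
by apply: eq_bigr => w _; rewrite innerZl innerZr mulrA mulrC.
Qed.

Definition fock_basis (w : seq 'I_n) : fock n (scalars R) :=
  fock_of (fun v => (v == w)%:R : scalars R).

Lemma fock_basisE w : val (fock_basis w) = fun v => (v == w)%:R : scalars R.
Proof.
apply/fock_ofE/asboolP; apply: (proj1 (csum_single (k := size w) _)) => m mw.
rewrite /level big1// => v _.
rewrite (_ : (_ == w) = false) ?inner0l//; apply/eqP => vw.
by move: mw; rewrite -vw size_tuple eqxx.
Qed.

Lemma fock_tensor_total H (u : fock n H) :
  (forall w h, inner u (fock_tensor (fock_basis w) h) = 0) -> u = 0.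
Proof.
move=> u0; apply/val_inj; rewrite funeqE => w; apply/eqP/negP => /negP uw0.
have := inner_gt0 uw0; rewrite -(u0 w (val u w)).
rewrite inner_fock fock_tensorE fock_basisE.
rewrite (proj2 (csum_single (k := size w) _)) => [|m mw].
  rewrite /level (bigD1 (in_tuple w))//= big1 ?addr0 => [|v vw].
    by rewrite eqxx scale1r ltxx.
  rewrite (_ : (_ == w) = false) ?scale0r ?inner0r//.
  by apply/negbTE; apply: contra vw => /eqP vw; apply/eqP/val_inj.
rewrite /level big1// => v _.
rewrite (_ : (_ == w) = false) ?scale0r ?inner0r//; apply/eqP => vw.
by move: mw; rewrite -vw size_tuple eqxx.
Qed.

Lemma fock_map_tensor H K (f : {linear H -> K}) (M : R) g (h : H) :
  (forall x, `|f x| <= M%:C%C * `|x|) ->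
  fock_map f (fock_tensor g h) = fock_tensor g (f h).
Proof.
move=> fM; apply/val_inj; rewrite (fock_mapE _ fM) !fock_tensorE.
by rewrite funeqE => w; rewrite linearZ.
Qed.

Lemma rcreation_tensor H (j : 'I_n) g (h : H) :
  rcreation j (fock_tensor g h) = fock_tensor (rcreation j g) h.
Proof.
apply/val_inj; rewrite funeqE => w.
rewrite (rcreationE j (fock_tensor g h)) (fock_tensorE (rcreation j g) h).
rewrite (rcreationE j g) (fock_tensorE g h).
case: w => [|i w]; first by rewrite scale0r.
by case: ifP => // _; rewrite scale0r.
Qed.

Lemma rcreation_basis (j : 'I_n) w :
  rcreation j (fock_basis w) = fock_basis (rcons w j).
Proof.
apply/val_inj; rewrite funeqE => v.
rewrite (rcreationE j (fock_basis w)) (fock_basisE (rcons w j)) (fock_basisE w).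
case: v => [|i v]; first by case: w.
rewrite lastI eqseq_rcons; case: eqP => //; by rewrite ?andbT ?andbF.
Qed.

End FockTensor.

Section CharacteristicFunction.
Variables (R : realType) (n : nat) (H : hilbertType R).
Variable T : 'I_n -> {linear H -> H}.

Definition amp_row : hpow 'I_n (fock n H) -> fock n H :=
  row_op (fun j => fock_map (T j)).

Definition creation_row : hpow 'I_n (fock n H) -> fock n H :=
  row_op (fun j => @rcreation R n H j).

Definition Theta_r (r : R) (u : hpow 'I_n (fock n H)) : fock n H :=
  - amp_row u +
  defect (adj amp_row)
    (op_inv (fun v : fock n H => v - r%:C%C *: creation_row (adj amp_row v))
       (r%:C%C *: creation_row (defect amp_row u))).

(* The pointwise limit, read in Gamma (x) D_(T^* ). *)
Definition charfun (f : fock n (defect_space (row_op T))) :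
    fock n (defect_space (adj (row_op T))) :=
  xget 0 [set g : fock n (defect_space (adj (row_op T))) |
    Theta_r r (fock_pow (fock_map (@subspace_incl _ _ _) f)) @[r --> (1 : R)^'-]
      --> fock_map (@subspace_incl _ _ _) g].

End CharacteristicFunction.

Arguments charfun {R n H} T f.
Arguments julia {R H K} L x.

(* Main.v *)
Require Import Defs.
From HB Require Import structures.
From mathcomp Require Import all_boot all_order all_algebra complex.
From mathcomp Require Import boolp classical_sets functions reals topology.
From mathcomp Require Import normedtype sequences realfun ring lra.

(** The theorem is the cascade (series connection) rule for conservative linear
    systems.  For a contraction [C] the block operator built from [- C],
    [defect (adj C)], [defect C] and [adj C] preserves the sum of squared norms
    ([colligation]).  Reading it as a discrete system whose time is the free
    monoid of words, an input [f] drives a state [x] by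

      x [::] = 0,   x (w j) = r (defect C (f w) + adj C (x w))_j

    and produces the output [- C (f w) + defect (adj C) (x w)]; this is
    [theta_rel C r].  Expanding the resolvent word by word shows that, for
    r < 1, [Theta_r] is exactly this input-output map ([Theta_rE]).

    The recursion also makes sense for r = 1, where there is no resolvent, and
    conservation of energy still bounds the output by the input.  The radial
    limit is the output at r = 1: if [dilate r] multiplies the coefficient at
    [w] by r to the power [size w], it carries the system with parameter 1 to
    the one with parameter r, it tends strongly to the identity, and the
    systems with parameter r are uniformly contractive.  So the limit defining
    [charfun] exists, and [charfun] is characterized by [theta_rel C 1]
    ([charfunE], [theta_rel_charfun]).

    The factorization then becomes an identity at each word.  If (a, l) is
    [sigma f], feed a into the system of [A], mix its output with l by the
    Julia-Halmos matrix, and feed the first component of the result into the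
    system of [B].  The pair of the two states satisfies the recursion of [T],
    and the two outputs assemble to the image under [sigma_s] of the output of
    [T] ([theta_cascade]).  This rests on formulas for the entries of [adj T],
    [defect T] and [T] in the coordinates given by [sigma] and [sigma_s]
    ([adj_block], [defect_block], [output_block]).

    Adjoints and square roots being given by definite descriptions, their
    existence has to be established: adjoints come from Riesz representation,
    and the square root of [1 - Q] is the limit of a monotone iteration.  The
    amplification of an operator to the Fock space commutes with taking
    adjoints and defect operators because these are unique. *)

Set Implicit Arguments.
Unset Strict Implicit.
Unset Printing Implicit Defensive.

Import Order.TTheory GRing.Theory Num.Theory.
Import numFieldNormedType.Exports.

Local Open Scope classical_set_scope.
Local Open Scope ring_scope.

(** * Inner products, norms and limits *)

Lemma innerNl (R : realType) (H : hilbertType R) (x y : H) :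
  inner (- x) y = - inner x y.
Proof. by rewrite -scaleN1r innerZl mulN1r. Qed.

Lemma innerBl (R : realType) (H : hilbertType R) (x y z : H) :
  inner (x - y) z = inner x z - inner y z.
Proof. by rewrite innerDl innerNl. Qed.

Lemma sqn_eq0 (R : realType) (H : hilbertType R) (x : H) : sqn x = 0 -> x = 0.
Proof.
move=> x0; apply/eqP/negP => /negP /inner_gt0.
by rewrite sqnE x0 ltxx.
Qed.

Lemma inner_injl (R : realType) (H : hilbertType R) (x y : H) :
  (forall z, inner x z = inner y z) -> x = y.
Proof.
move=> xy; apply/subr0_eq/sqn_eq0.
by rewrite /sqn innerBl xy subrr.
Qed.

(** Estimates are carried out in [R], which is totally ordered while [R[i]] is
    not; the real part of the inner product still determines the vectors. *)
Definition rinner (R : realType) (H : hilbertType R) (x y : H) : R :=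
  complex.Re (inner x y).

Lemma rinnerC (R : realType) (H : hilbertType R) (x y : H) :
  rinner y x = rinner x y.
Proof. by rewrite /rinner innerC; case: (inner x y). Qed.

Lemma rinnerDl (R : realType) (H : hilbertType R) (x y z : H) :
  rinner (x + y) z = rinner x z + rinner y z.
Proof. by rewrite /rinner innerDl raddfD. Qed.

Lemma rinnerNl (R : realType) (H : hilbertType R) (x y : H) :
  rinner (- x) y = - rinner x y.
Proof. by rewrite /rinner innerNl raddfN. Qed.

Lemma rinnerBl (R : realType) (H : hilbertType R) (x y z : H) :
  rinner (x - y) z = rinner x z - rinner y z.
Proof. by rewrite rinnerDl rinnerNl. Qed.

Lemma rinnerZl (R : realType) (H : hilbertType R) (s : R) (x y : H) :
  rinner (s%:C%C *: x) y = s * rinner x y.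
Proof.
rewrite /rinner innerZl; case: (inner x y) => a b /=.
by rewrite mul0r subr0.
Qed.

Lemma rinnerDr (R : realType) (H : hilbertType R) (x y z : H) :
  rinner z (x + y) = rinner z x + rinner z y.
Proof. by rewrite rinnerC rinnerDl ![rinner _ z]rinnerC. Qed.

Lemma rinnerBr (R : realType) (H : hilbertType R) (x y z : H) :
  rinner z (x - y) = rinner z x - rinner z y.
Proof. by rewrite rinnerC rinnerBl ![rinner _ z]rinnerC. Qed.

Lemma rinnerZr (R : realType) (H : hilbertType R) (s : R) (x y : H) :
  rinner x (s%:C%C *: y) = s * rinner x y.
Proof. by rewrite rinnerC rinnerZl rinnerC. Qed.

Lemma sqnDE (R : realType) (H : hilbertType R) (x y : H) :
  sqn (x + y) = sqn x + 2 * rinner x y + sqn y.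
Proof.
rewrite -[LHS]/(rinner (x + y) (x + y)) !(rinnerDl, rinnerDr) (rinnerC x y).
rewrite -/(rinner x x) -/(rinner y y) /sqn -!/(rinner _ _); ring.
Qed.

Lemma sqnBE (R : realType) (H : hilbertType R) (x y : H) :
  sqn (x - y) = sqn x - 2 * rinner x y + sqn y.
Proof. by rewrite sqnDE sqnN rinnerC rinnerNl rinnerC mulrN. Qed.

Lemma sqnZr (R : realType) (H : hilbertType R) (s : R) (x : H) :
  sqn (s%:C%C *: x) = s ^+ 2 * sqn x.
Proof. by rewrite -[LHS]/(rinner _ _) rinnerZl rinnerZr mulrA. Qed.

Lemma sqn0 (R : realType) (H : hilbertType R) : sqn (0 : H) = 0.
Proof. by rewrite /sqn inner0l. Qed.

Lemma rinner_injl (R : realType) (H : hilbertType R) (x y : H) :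
  (forall z, rinner x z = rinner y z) -> x = y.
Proof.
move=> xy; apply/subr0_eq/sqn_eq0.
by rewrite -[LHS]/(rinner _ _) rinnerBl xy subrr.
Qed.

Lemma normE_sqn (R : realType) (H : hilbertType R) (x : H) :
  `|x| = (Num.sqrt (sqn x))%:C%C.
Proof.
apply/eqP; rewrite -(@eqrXn2 _ 2)// ?lecR ?sqrtr_ge0//.
by rewrite -inner_norm -rmorphXn/= sqr_sqrtr ?sqn_ge0// -sqnE.
Qed.

Lemma norm_le_sqn (R : realType) (H K : hilbertType R) (x : H) (y : K) :
  (`|x| <= `|y|) = (sqn x <= sqn y).
Proof. by rewrite !normE_sqn lecR ler_sqrt// sqn_ge0. Qed.

Lemma contractive_sqn (R : realType) (H K : hilbertType R) (C : H -> K) :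
  contractive_op C <-> forall x, sqn (C x) <= sqn x.
Proof. by split=> h x; have := h x; rewrite norm_le_sqn. Qed.

Lemma rinner_cs (R : realType) (H : hilbertType R) (x y : H) :
  rinner x y ^+ 2 <= sqn x * sqn y.
Proof.
have := @ip_cs R H (@inner R H) (@innerDZl R H) (@innerC R H) (@inner_gt0 R H) x y.
have nE z : ip_norm inner z = `|z| :> R[i] by rewrite /ip_norm inner_norm sqrCK.
rewrite !nE -(@ler_pXn2r _ 2)// ?nnegrE ?mulr_ge0// exprMn -!inner_norm !sqnE.
rewrite -add_Re2_Im2 -rmorphM lecR; apply: le_trans.
by rewrite lerDl sqr_ge0.
Qed.

Lemma cvg_sqnP (R : realType) (H : hilbertType R) (T : Type) (F : set_system T)
    (u : T -> H) (l : H) {FF : Filter F} :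
  (u @ F --> l) <-> (forall e : R, 0 < e -> \forall k \near F, sqn (u k - l) < e).
Proof.
split=> [/cvgrPdist_lt ul e e0|ul].
  have se0 : 0 < Num.sqrt e by rewrite sqrtr_gt0.
  have := ul (Num.sqrt e)%:C%C; rewrite ltcR => /(_ se0).
  apply: filterS => k; rewrite distrC normE_sqn ltcR.
  by rewrite ltr_sqrt.
apply/cvgrPdist_lt => eps eps0.
have -> : eps = (complex.Re eps)%:C%C by rewrite RRe_real// gtr0_real.
have e0 : 0 < complex.Re eps by rewrite -ltcR RRe_real// gtr0_real.
apply: filterS (ul _ (exprn_gt0 2 e0)) => k.
rewrite distrC normE_sqn ltcR => h.
by rewrite -[ltRHS]ger0_norm ?ltW// -sqrtr_sqr ltr_sqrt ?exprn_gt0.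
Qed.

(** Boundedness is stated with squares because that is the form in which the
    Cauchy-Schwarz inequality [rinner_cs] supplies it. *)
Lemma cvg_bounded_additive (R : realType) (H : hilbertType R) (T : Type)
    (F : set_system T) (f : H -> R) (M : R) (u : T -> H) (l : H) {FF : Filter F} :
  (forall x y, f (x - y) = f x - f y) -> (forall x, f x ^+ 2 <= M * sqn x) ->
  u @ F --> l -> f (u k) @[k --> F] --> f l.
Proof.
move=> fB fM /cvg_sqnP ul; apply/cvgrPdist_lt => e e0.
have M1 : 0 < `|M| + 1 by rewrite ltr_wpDl.
have e2 : 0 < e ^+ 2 / (`|M| + 1) by rewrite divr_gt0// exprn_gt0.
apply: filterS (ul _ e2) => k.
rewrite ltr_pdivlMr// => h.
rewrite distrC -fB -(@ltr_pXn2r _ 2)// ?nnegrE ?normr_ge0 ?(ltW e0)// real_normK ?num_real//.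
apply: le_lt_trans (fM _) _; apply: le_lt_trans h.
rewrite mulrC ler_wpM2l ?sqn_ge0//.
by rewrite (le_trans (ler_norm _))// lerDl.
Qed.

Lemma cvg_rinner (R : realType) (H : hilbertType R) (T : Type)
    (F : set_system T) (u : T -> H) (l v : H) {FF : Filter F} :
  u @ F --> l -> rinner (u k) v @[k --> F] --> rinner l v.
Proof.
apply: (@cvg_bounded_additive _ _ _ _ (fun x => rinner x v) (sqn v)) => [x y|x].
  by rewrite rinnerBl.
by rewrite mulrC rinner_cs.
Qed.

Lemma cvg_sqn (R : realType) (H : hilbertType R) (T : Type)
    (F : set_system T) (u : T -> H) (l : H) {FF : Filter F} :
  u @ F --> l -> sqn (u k) @[k --> F] --> sqn l.
Proof.
move=> ul.
have -> : (fun k => sqn (u k)) =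
    (fun k => sqn (u k - l) + (2 * rinner (u k) l - sqn l)).
  apply/funext => k; rewrite sqnBE; ring.
rewrite [X in _ --> X](_ : _ = 0 + (2 * rinner l l - sqn l)); last first.
  by rewrite -[sqn l]/(rinner l l); ring.
apply: cvgD; last first.
  by apply: cvgB; [apply: cvgMr; exact: cvg_rinner|exact: cvg_cst].
apply/cvgrPdist_lt => e e0; move/cvg_sqnP : ul => /(_ _ e0).
by apply: filterS => k; rewrite sub0r normrN ger0_norm// sqn_ge0.
Qed.

(** The form of completeness used both for minimizing sequences and for the
    square root iteration: each comes with an explicit null majorant [c]. *)
Lemma sqn_cauchy (R : realType) (H : hilbertType R) (u : nat -> H) (c : nat -> R) :
  c @ \oo --> (0 : R) ->
  (forall p q, (p <= q)%N -> sqn (u p - u q) <= c p) ->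
  exists l : H, u @ \oo --> l.
Proof.
move=> c0 uc; have [e e0|l [ul _]] := @inner_complete R H u; last by exists l.
have /cvgrPdist_lt/(_ _ e0)[N _ hN] := c0.
have key p q : (N <= p)%N -> (p <= q)%N -> inner (u p - u q) (u p - u q) < e%:C%C.
  move=> Np pq; rewrite sqnE ltcR (le_lt_trans (uc _ _ pq))//.
  have := hN p Np; rewrite /= sub0r normrN; apply: le_lt_trans.
  exact: ler_norm.
exists N => p q Np Nq; have [pq|qp] := leqP p q; first exact: key.
rewrite sqnE -sqnN opprB -sqnE; exact: key (ltnW qp).
Qed.

(** * Riesz representation and adjoints *)

(** The representing vector minimizes [sqn x - 2 * f x]; a minimizing sequence
    is Cauchy by the parallelogram law, and the first variation at the minimum
    says that [f] and [rinner _ y] agree. *)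
Lemma riesz_real (R : realType) (H : hilbertType R) (f : H -> R) (M : R) :
  (forall (s : R) x y, f (s%:C%C *: x + y) = s * f x + f y) ->
  (forall x, f x ^+ 2 <= M * sqn x) ->
  exists y, forall x, f x = rinner x y.
Proof.
move=> flin fM.
have f0 : f 0 = 0 by have := flin (-1) 0 0; rewrite scaler0 addr0; lra.
have fD x y : f (x + y) = f x + f y.
  by have := flin 1 x y; rewrite scale1r mul1r.
have fZ (s : R) x : f (s%:C%C *: x) = s * f x.
  by have := flin s x 0; rewrite addr0 f0 addr0.
have fB x y : f (x - y) = f x - f y.
  have := flin (-1) y x; rewrite rmorphN1 scaleN1r addrC => ->; ring.
pose J x := sqn x - 2 * f x.
have JM x : - (`|M| + 1) <= J x.
  have := fM x; rewrite /J; have := sqn_ge0 x; have := normr_ge0 M.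
  have := ler_norm M.
  move: (sqn x) (f x) `|M| => a b m h1 h2 h3 h4.
  have : b ^+ 2 <= m * a by apply: le_trans h4 _; rewrite ler_wpM2r.
  move=> {}h4.
  have : 0 <= (b - (m + 1)) ^+ 2 by rewrite sqr_ge0.
  nra.
pose m := inf (range J).
have hinf : has_inf (range J).
  by split; [exists (J 0), 0|exists (- (`|M| + 1)) => _ [x _ <-]].
have mJ x : m <= J x by apply: ge_inf; [case: hinf|exists x].
have /choice[u uJ] k : exists x, J x < m + k.+1%:R^-1.
  have k0 : 0 < (k.+1%:R^-1 : R) by rewrite invr_gt0.
  by have [_ [x _ <-] xm] := inf_adherent k0 hinf; exists x.
have Jpar x y : sqn (x - y) <= 2 * (J x - m) + 2 * (J y - m).
  have := mJ ((2^-1 : R)%:C%C *: (x + y)); rewrite /J sqnZr fZ fD.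
  have -> : (2^-1 : R) ^+ 2 = 4^-1 by field.
  have := sqnD x y; move: (sqn _) (sqn _) (sqn x) (sqn y) => *; lra.
have [||y uy] := @sqn_cauchy _ _ u (fun k => 4 * k.+1%:R^-1).
- rewrite [X in _ --> X](_ : _ = 4 * 0); last by rewrite mulr0.
  by apply: cvgMr; exact: cvg_harmonic.
- move=> p q pq; apply: le_trans (Jpar _ _) _.
  have := uJ p; have := uJ q.
  have : (q.+1%:R^-1 : R) <= p.+1%:R^-1 by rewrite lef_pV2 ?posrE// ler_nat ltnS.
  move: (J (u p)) (J (u q)) => /=.
  by move: (p.+1%:R^-1 : R) (q.+1%:R^-1 : R) => *; lra.
have Jy : J y <= m.
  have cJ : J (u k) @[k --> \oo] --> J y.
    apply: cvgB; first exact: cvg_sqn.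
    by apply: cvgMr; exact: (cvg_bounded_additive fB fM uy).
  have cm : (m + k.+1%:R^-1) @[k --> \oo] --> m + 0.
    by apply: cvgD; [exact: cvg_cst|exact: cvg_harmonic].
  rewrite -[leRHS]addr0; apply: (ler_cvg_to cJ cm).
  by apply: nearW => k; exact/ltW/uJ.
exists y => x.
have var (s : R) : 0 <= s ^+ 2 * sqn x + 2 * s * (rinner x y - f x).
  have := le_trans Jy (mJ (s%:C%C *: x + y)).
  rewrite /J sqnDE sqnZr rinnerZl flin; lra.
set a := sqn x in var; set b := rinner x y - f x in var.
have a0 : 0 <= a := sqn_ge0 x.
suff b0 : b = 0 by move: b0; rewrite /b; lra.
(* The optimal step is - b / a; the denominator a + 1 also covers a = 0. *)
have := var (- (b / (a + 1))).
have a1 : 0 < a + 1 by rewrite ltr_wpDl.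
set c := b / (a + 1) => h.
have bc : b = c * (a + 1) by rewrite /c mulfVK// gt_eqF.
suff c0 : c = 0 by rewrite bc c0 mul0r.
move: h; rewrite bc => h.
apply/eqP; rewrite -sqrf_eq0 eq_le sqr_ge0 andbT.
nra.
Qed.

Lemma complex_Re_i (R : realType) (z : R[i]) :
  complex.Re ('i%C * z) = - complex.Im z.
Proof. by case: z => a b /=; rewrite mul0r mul1r sub0r. Qed.

(** A complex-linear functional is determined by its real part, since its
    imaginary part at [x] is minus the real part at [i x]. *)
Lemma inner_of_rinner (R : realType) (H : hilbertType R) (f : H -> R[i]) (y : H) :
  (forall x, f ('i%C *: x) = 'i%C * f x) ->
  (forall x, complex.Re (f x) = rinner x y) -> forall x, f x = inner x y.
Proof.
move=> fi fr x; apply/eqP; rewrite eq_complex fr eqxx/=.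
rewrite -eqr_opp -!complex_Re_i -fi fr /rinner innerZl.
by rewrite eqxx.
Qed.

Lemma the_linearP (R : realType) (H K : hilbertType R) (P : set {linear H -> K}) :
  (exists f, P f) -> P (the_linear P).
Proof. by move=> exP; rewrite /the_linear; case: pselect => // h; case: cid. Qed.

Lemma adj_unique (R : realType) (H K : hilbertType R) (C : H -> K) (D : {linear K -> H}) :
  (forall x y, inner (C x) y = inner x (D y)) -> adj C = D :> (K -> H).
Proof.
move=> CD; have := @the_linearP _ _ _
  [set C' : {linear K -> H} | forall x y, inner (C x) y = inner x (C' y)].
move=> /(_ (ex_intro _ D CD)) /= CA; apply/funext => y; apply: inner_injl => z.
by rewrite innerC [RHS]innerC -CD CA.
Qed.

Lemma adjP (R : realType) (H K : hilbertType R) (C : {linear H -> K}) :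
  contractive_op C -> forall x y, inner (C x) y = inner x (adj C y).
Proof.
move=> /contractive_sqn C1.
apply: (@the_linearP _ _ _
  [set C' : {linear K -> H} | forall x y, inner (C x) y = inner x (C' y)]).
have /choice[D DP] y : exists z, forall x, inner (C x) y = inner x z.
  have [s x z|x|z zP] := @riesz_real _ _ (fun x => rinner (C x) y) (sqn y).
  - by rewrite linearP rinnerDl rinnerZl.
  - by rewrite mulrC (le_trans (rinner_cs _ _))// ler_wpM2r// sqn_ge0.
  - exists z; apply: inner_of_rinner => x; last exact: zP.
    by rewrite linearZ innerZl.
have Dlin : linear D.
  move=> a x y; apply: inner_injl => z; rewrite innerC [RHS]innerC; congr (_^*).
  by rewrite -DP innerDr innerZr !DP -innerZr -innerDr.
pose DL := GRing.isLinear.Build _ _ _ _ D Dlin.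
pose D' : {linear K -> H} := HB.pack D DL.
by exists D' => x y; exact: DP.
Qed.

Lemma rinner_adj (R : realType) (H K : hilbertType R) (C : {linear H -> K}) :
  contractive_op C -> forall x y, rinner (C x) y = rinner x (adj C y).
Proof. by move=> C1 x y; rewrite /rinner adjP. Qed.

Lemma rinner_adjr (R : realType) (H K : hilbertType R) (C : {linear H -> K}) :
  contractive_op C -> forall x y, rinner x (C y) = rinner (adj C x) y.
Proof. by move=> C1 x y; rewrite rinnerC rinner_adj// rinnerC. Qed.

(** Cauchy-Schwarz for [C (adj C y)] and [y], divided by [sqn (adj C y)]. *)
Lemma sqn_adj_le (R : realType) (H K : hilbertType R) (C : {linear H -> K}) :
  contractive_op C -> forall y, sqn (adj C y) <= sqn y.
Proof.
move=> C1 y; have C1' := (contractive_sqn C).1 C1.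
have := rinner_cs (C (adj C y)) y.
rewrite rinner_adj// -/(sqn _) => h.
have h2 : sqn (adj C y) ^+ 2 <= sqn (adj C y) * sqn y.
  by apply: le_trans h _; rewrite ler_wpM2r ?sqn_ge0// C1'.
have [->|a0] := eqVneq (sqn (adj C y)) 0; first exact: sqn_ge0.
by rewrite -(@ler_pM2l _ (sqn (adj C y)))// lt_neqAle eq_sym a0 sqn_ge0.
Qed.

Lemma adj_contractive (R : realType) (H K : hilbertType R) (C : {linear H -> K}) :
  contractive_op C -> contractive_op (adj C).
Proof. by move=> C1; apply/contractive_sqn/sqn_adj_le. Qed.

Lemma adjK (R : realType) (H K : hilbertType R) (C : {linear H -> K}) :
  contractive_op C -> adj (adj C) = C :> (H -> K).
Proof.
by move=> C1; apply: adj_unique => x y; rewrite innerC [RHS]innerC adjP.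
Qed.

(** * Square roots *)

Definition rnorm (R : realType) (H : hilbertType R) (x : H) : R :=
  Num.sqrt (sqn x).

Lemma rnorm_ge0 (R : realType) (H : hilbertType R) (x : H) : 0 <= rnorm x.
Proof. exact: sqrtr_ge0. Qed.

Lemma sqr_rnorm (R : realType) (H : hilbertType R) (x : H) :
  rnorm x ^+ 2 = sqn x.
Proof. by rewrite sqr_sqrtr// sqn_ge0. Qed.

Lemma rnormD (R : realType) (H : hilbertType R) (x y : H) :
  rnorm (x + y) <= rnorm x + rnorm y.
Proof. by have := ler_normD x y; rewrite !normE_sqn -rmorphD lecR. Qed.

Lemma rnormN (R : realType) (H : hilbertType R) (x : H) : rnorm (- x) = rnorm x.
Proof. by rewrite /rnorm sqnN. Qed.

Lemma rnormZ (R : realType) (H : hilbertType R) (s : R) (x : H) :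
  0 <= s -> rnorm (s%:C%C *: x) = s * rnorm x.
Proof. by move=> s0; rewrite /rnorm sqnZr sqrtrM ?sqr_ge0// sqrtr_sqr ger0_norm. Qed.

Lemma rnorm_le (R : realType) (H K : hilbertType R) (x : H) (y : K) :
  (rnorm x <= rnorm y) = (sqn x <= sqn y).
Proof. by rewrite ler_sqrt// sqn_ge0. Qed.

Lemma hilbert_cvg_unique (R : realType) (H : hilbertType R) (T : Type)
    (F : set_system T) (u : T -> H) (l m : H) {FF : ProperFilter F} :
  u @ F --> l -> u @ F --> m -> l = m.
Proof. apply: cvg_unique; exact: norm_hausdorff. Qed.

Notation half R := ((2^-1 : R)%:C%C).

(** The iteration for Y = (Q + Y^2) / 2, whose solution gives the square root
    1 - Y of 1 - Q.  The increment [d] is carried along, because the recursion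
    d' = d (Y + Y') / 2 exhibits it as a polynomial in [Q] with nonnegative
    coefficients: its norm is then bounded by the same polynomial at 1. *)
Fixpoint sqrt_iter (R : realType) (H : hilbertType R) (Q : H -> H) (n : nat) :
    (H -> H) * (H -> H) :=
  if n is n'.+1 then
    let: (Y, d) := sqrt_iter Q n' in
    (fun x => Y x + d x, fun x => half R *: (d (Y x) + d (Y x + d x)))
  else (fun=> 0, fun x => half R *: Q x).

Notation sqrtY Q n := (sqrt_iter Q n).1.
Notation sqrtD Q n := (sqrt_iter Q n).2.

Lemma sqrtYS (R : realType) (H : hilbertType R) (Q : H -> H) n x :
  sqrtY Q n.+1 x = sqrtY Q n x + sqrtD Q n x.
Proof. by rewrite /=; case: (sqrt_iter Q n). Qed.

Lemma sqrtDS (R : realType) (H : hilbertType R) (Q : H -> H) n x :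
  sqrtD Q n.+1 x = half R *: (sqrtD Q n (sqrtY Q n x) + sqrtD Q n (sqrtY Q n.+1 x)).
Proof. by rewrite /=; case: (sqrt_iter Q n). Qed.

(** Applied to [X = Q], and then to the iterates themselves, this yields that
    everything built from [Q] commutes. *)
Lemma sqrt_iter_intertwine (R : realType) (H K : hilbertType R)
    (Q1 : H -> H) (Q2 : K -> K) (X : {linear H -> K}) n :
  (forall x, X (Q1 x) = Q2 (X x)) ->
  (forall x, X (sqrtY Q1 n x) = sqrtY Q2 n (X x)) /\
  (forall x, X (sqrtD Q1 n x) = sqrtD Q2 n (X x)).
Proof.
move=> XQ; elim: n => [|n [IY ID]].
  by split=> x; rewrite /= ?linear0// linearZ /= XQ.
have IYS x : X (sqrtY Q1 n.+1 x) = sqrtY Q2 n.+1 (X x).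
  by rewrite !sqrtYS linearD IY ID.
by split=> // x; rewrite !sqrtDS linearZ linearD/= !ID IY IYS.
Qed.

Lemma sqrt_iter_linear (R : realType) (H : hilbertType R) (Q : {linear H -> H}) n :
  linear (sqrtY Q n) /\ linear (sqrtD Q n).
Proof.
elim: n => [|n [IY ID]].
  split=> a x y /=; first by rewrite scaler0 addr0.
  by rewrite linearP scalerDr !scalerA mulrC.
have IYS : linear (sqrtY Q n.+1).
  by move=> a x y; rewrite !sqrtYS IY ID scalerDr addrACA.
split=> // a x y; rewrite !sqrtDS IY IYS !ID scalerA mulrC -scalerA -scalerDr.
by congr (_ *: _); rewrite scalerDr addrACA.
Qed.

(** Turns a plain function into a term of the bundled type, to which the
    statements on linear maps apply. *)
Lemma linear_funP (R : realType) (H K : hilbertType R) (f : H -> K) :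
  linear f -> exists g : {linear H -> K}, f = g.
Proof.
move=> fl; pose fL := GRing.isLinear.Build _ _ _ _ f fl.
pose g : {linear H -> K} := HB.pack f fL.
by exists g.
Qed.

Lemma sqrt_iter_comm (R : realType) (H : hilbertType R) (Q : {linear H -> H}) n x :
  sqrtD Q n (sqrtY Q n x) = sqrtY Q n (sqrtD Q n x).
Proof.
have [lY lD] := sqrt_iter_linear Q n.
have [gD eD] := linear_funP lD.
have gQ y : gD (Q y) = Q (gD y).
  by rewrite -eD (@sqrt_iter_intertwine _ _ _ Q Q Q n _).2.
by rewrite eD ((sqrt_iter_intertwine n gQ).1 x).
Qed.

Lemma sqrt_iter_fix (R : realType) (H : hilbertType R) (Q : {linear H -> H}) n x :
  sqrtY Q n.+1 x = half R *: (Q x + sqrtY Q n (sqrtY Q n x)).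
Proof.
elim: n x => [|n IH] x; first by rewrite sqrtYS /= addr0 add0r.
rewrite sqrtYS {1}IH sqrtDS -scalerDr; congr (_ *: _); rewrite -addrA; congr (_ + _).
have [/linear_funP[Y eY] /linear_funP[D eD]] := sqrt_iter_linear Q n.
have := sqrt_iter_comm Q n; rewrite !sqrtYS eY eD => cYD.
by rewrite !linearD/= !cYD !addrA.
Qed.

Lemma sqrt_iter_sa (R : realType) (H : hilbertType R) (Q : {linear H -> H}) n :
  (forall x y, rinner (Q x) y = rinner x (Q y)) ->
  (forall x y, rinner (sqrtY Q n x) y = rinner x (sqrtY Q n y)) /\
  (forall x y, rinner (sqrtD Q n x) y = rinner x (sqrtD Q n y)).
Proof.
move=> Qsa; elim: n => [|n [IY ID]].
  split=> x y /=; first by rewrite /rinner inner0l inner0r.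
  by rewrite rinnerZl rinnerZr Qsa.
have IYS x y : rinner (sqrtY Q n.+1 x) y = rinner x (sqrtY Q n.+1 y).
  by rewrite !sqrtYS rinnerDl rinnerDr IY ID.
have /linear_funP[D eD] := (sqrt_iter_linear Q n).2.
have cS z : sqrtY Q n.+1 (sqrtD Q n z) = sqrtD Q n (sqrtY Q n.+1 z).
  by rewrite !sqrtYS eD linearD/= -eD sqrt_iter_comm.
split=> // x y; rewrite !sqrtDS rinnerZl rinnerZr; congr (_ * _).
rewrite rinnerDl rinnerDr; congr (_ + _).
  by rewrite ID IY sqrt_iter_comm.
by rewrite ID IYS cS.
Qed.

(** The value of the iteration at [Q = 1]. *)
Fixpoint sqrt_bound (R : realType) (n : nat) : R :=
  if n is n'.+1 then (1 + sqrt_bound R n' ^+ 2) / 2 else 0.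

Lemma sqrt_bound_le (R : realType) n : 0 <= sqrt_bound R n <= 1.
Proof.
elim: n => [|n /andP[h0 h1]] /=; first by rewrite lexx ler01.
by apply/andP; split; nra.
Qed.

Lemma sqrt_bound_step (R : realType) n :
  0 <= sqrt_bound R n.+1 - sqrt_bound R n.
Proof.
have /andP[h0 h1] := sqrt_bound_le R n.
rewrite /=; have : 0 <= (1 - sqrt_bound R n) ^+ 2 by rewrite sqr_ge0.
nra.
Qed.

Lemma sqrt_iter_bound (R : realType) (H : hilbertType R) (Q : {linear H -> H}) n :
  contractive_op Q ->
  (forall x, rnorm (sqrtY Q n x) <= sqrt_bound R n * rnorm x) /\
  (forall x, rnorm (sqrtD Q n x) <=
     (sqrt_bound R n.+1 - sqrt_bound R n) * rnorm x).
Proof.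
move=> /contractive_sqn Q1; have half0 : 0 <= 2^-1 :> R by rewrite invr_ge0.
elim: n => [|n [IY ID]].
  split=> x; first by rewrite /= mul0r /rnorm sqn0 sqrtr0.
  rewrite [sqrtD _ _ _]/= rnormZ//= expr0n/= addr0 subr0 mul1r.
  by rewrite ler_wpM2l// rnorm_le.
have IYS x : rnorm (sqrtY Q n.+1 x) <= sqrt_bound R n.+1 * rnorm x.
  rewrite sqrtYS (le_trans (rnormD _ _))//.
  by have := IY x; have := ID x; lra.
split=> // x; rewrite sqrtDS rnormZ//.
set Y := sqrtY Q n x; set Y' := sqrtY Q n.+1 x.
have h := rnormD (sqrtD Q n Y) (sqrtD Q n Y').
have := ID Y; have := ID Y'; have := IY x; have := IYS x; rewrite -/Y -/Y'.
have := sqrt_bound_step R n.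
rewrite [sqrt_bound R n.+2]/= -/(sqrt_bound R n.+1).
have : sqrt_bound R n.+1 = (1 + sqrt_bound R n ^+ 2) / 2 by [].
move: h; set a := sqrt_bound R n; set b := sqrt_bound R n.+1.
move: (rnorm _) (rnorm x) (rnorm Y) (rnorm Y') (rnorm (sqrtD _ _ Y)) (rnorm (sqrtD _ _ Y')).
move=> s hx y y' dy dy' h eb ab hy' hy hdy' hdy.
have h1 : (b - a) * y <= (b - a) * (a * hx) by rewrite ler_wpM2l.
have h2 : (b - a) * y' <= (b - a) * (b * hx) by rewrite ler_wpM2l.
have -> : ((1 + b ^+ 2) / 2 - b) * hx = 2^-1 * ((b - a) * (a * hx) + (b - a) * (b * hx)).
  by rewrite [in X in _ - X]eb; field.
by apply: ler_wpM2l => //; lra.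
Qed.

Lemma cvg_sqrt_bound (R : realType) :
  exists l : R, sqrt_bound R @ \oo --> l /\ forall n, sqrt_bound R n <= l.
Proof.
have nd : {homo sqrt_bound R : n m / (n <= m)%N >-> n <= m}.
  apply/nondecreasing_seqP => n; rewrite -subr_ge0; exact: sqrt_bound_step.
have cv : cvgn (sqrt_bound R).
  apply: nondecreasing_is_cvgn => //; exists 1 => _ [n _ <-].
  by have /andP[] := sqrt_bound_le R n.
exists (limn (sqrt_bound R)); split=> // n.
exact: nondecreasing_cvgn_le.
Qed.

Definition sqrt_lim (R : realType) (H : hilbertType R) (Q : H -> H) (x : H) : H :=
  lim ((fun n => sqrtY Q n x) @ \oo).

Lemma cvg_sqrt_lim (R : realType) (H : hilbertType R) (Q : {linear H -> H}) x :
  contractive_op Q -> sqrtY Q n x @[n --> \oo] --> sqrt_lim Q x.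
Proof.
move=> Q1; have [l [al l_ub]] := cvg_sqrt_bound R.
have key p q : (p <= q)%N -> rnorm (sqrtY Q p x - sqrtY Q q x) <=
    (sqrt_bound R q - sqrt_bound R p) * rnorm x.
  move=> /subnK <-; elim: (q - p)%N => [|k IH].
    by rewrite add0n !subrr mul0r /rnorm sqn0 sqrtr0.
  rewrite addSn sqrtYS opprD addrA.
  apply: le_trans (rnormD _ _) _; rewrite rnormN.
  have := (sqrt_iter_bound (k + p) Q1).2 x; move: IH; lra.
have [||z zP] := @sqn_cauchy _ _ (fun n => sqrtY Q n x)
    (fun n => (l - sqrt_bound R n) ^+ 2 * sqn x).
- rewrite [X in _ --> X](_ : _ = (l - l) ^+ 2 * sqn x); last first.
    by rewrite subrr expr0n mul0r.
  apply: cvgMl; rewrite expr2; apply: cvgM; apply: cvgB => //; exact: cvg_cst.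
- move=> p q pq /=; rewrite -!sqr_rnorm -exprMn.
  rewrite ler_pXn2r ?nnegrE ?mulr_ge0 ?rnorm_ge0 ?subr_ge0//.
  apply: le_trans (key _ _ pq) _.
  by apply: ler_wpM2r; [exact: rnorm_ge0|rewrite lerD2r].
by apply/cvg_ex; exists z.
Qed.

Arguments cvg_sqrt_lim [R H Q] x _.

Lemma linear_sqrt_lim (R : realType) (H : hilbertType R) (Q : {linear H -> H}) :
  contractive_op Q -> linear (sqrt_lim Q).
Proof.
move=> Q1 a x y; apply: hilbert_cvg_unique (cvg_sqrt_lim _ Q1) _.
rewrite (_ : (fun n => _) = fun n => a *: sqrtY Q n x + sqrtY Q n y); last first.
  by apply/funext => n; rewrite (sqrt_iter_linear Q n).1.
by apply: cvgD; [apply: cvgZr; exact: cvg_sqrt_lim|exact: cvg_sqrt_lim].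
Qed.

Lemma sqn_sqrtY_le (R : realType) (H : hilbertType R) (Q : {linear H -> H}) n x :
  contractive_op Q -> sqn (sqrtY Q n x) <= sqn x.
Proof.
move=> Q1; rewrite -rnorm_le; apply: le_trans ((sqrt_iter_bound n Q1).1 x) _.
have /andP[a0 a1] := sqrt_bound_le R n.
by rewrite ler_piMl// rnorm_ge0.
Qed.

Lemma sqn_sqrt_lim_le (R : realType) (H : hilbertType R) (Q : {linear H -> H}) x :
  contractive_op Q -> sqn (sqrt_lim Q x) <= sqn x.
Proof.
move=> Q1; have sY : sqn (sqrtY Q n x) @[n --> \oo] --> sqn (sqrt_lim Q x).
  exact: (cvg_sqn (cvg_sqrt_lim x Q1)).
have sx : sqn x @[n --> \oo] --> sqn x by exact: cvg_cst.
apply: (ler_cvg_to sY sx).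
by apply: nearW => n; exact: sqn_sqrtY_le.
Qed.

Lemma sqrt_lim_sa (R : realType) (H : hilbertType R) (Q : {linear H -> H}) :
  contractive_op Q -> (forall x y, rinner (Q x) y = rinner x (Q y)) ->
  forall x y, rinner (sqrt_lim Q x) y = rinner x (sqrt_lim Q y).
Proof.
move=> Q1 Qsa x y; 
have h z t : rinner (sqrtY Q n z) t @[n --> \oo] --> rinner (sqrt_lim Q z) t.
  exact: (cvg_rinner (cvg_sqrt_lim z Q1)).
rewrite [RHS]rinnerC; apply: cvg_unique (h x y) _; first exact: norm_hausdorff.
have -> : (fun n => rinner (sqrtY Q n x) y) = (fun n => rinner (sqrtY Q n y) x).
  by apply/funext => n; rewrite (sqrt_iter_sa n Qsa).1 rinnerC.
exact: h.
Qed.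

Lemma sqrt_lim_fix (R : realType) (H : hilbertType R) (Q : {linear H -> H}) x :
  contractive_op Q ->
  sqrt_lim Q x = half R *: (Q x + sqrt_lim Q (sqrt_lim Q x)).
Proof.
move=> Q1; have YP := fun z => cvg_sqrt_lim z Q1.
have h := YP x; rewrite -cvg_shiftS in h.
apply: hilbert_cvg_unique h _.
rewrite (_ : (fun n => _) =
  fun n => half R *: (Q x + sqrtY Q n (sqrtY Q n x))); last first.
  by apply/funext => n; rewrite sqrt_iter_fix.
apply: cvgZr; apply: cvgD; first exact: cvg_cst.
rewrite (_ : (fun n => _) = fun n => (sqrtY Q n (sqrtY Q n x - sqrt_lim Q x)) +
    sqrtY Q n (sqrt_lim Q x)); last first.
  apply/funext => n; have /linear_funP[Y ->] := (sqrt_iter_linear Q n).1.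
  by rewrite -linearD subrK.
rewrite -[X in _ --> X]add0r; apply: cvgD => //.
apply/cvg_sqnP => e e0; have /cvg_sqnP/(_ _ e0) := YP x.
by apply: filterS => n; rewrite subr0; apply: le_lt_trans; exact: sqn_sqrtY_le.
Qed.

(** Passing to the limit in [sqrt_iter_intertwine]; this replaces functional
    calculus in the intertwining relations for defect operators. *)
Lemma sqrt_lim_intertwine (R : realType) (H K : hilbertType R)
    (Q1 : {linear H -> H}) (Q2 : {linear K -> K}) (X : {linear H -> K}) :
  continuous X -> contractive_op Q1 -> contractive_op Q2 ->
  (forall x, X (Q1 x) = Q2 (X x)) ->
  forall x, X (sqrt_lim Q1 x) = sqrt_lim Q2 (X x).
Proof.
move=> Xc Q1c Q2c XQ x; apply/esym; apply: hilbert_cvg_unique (cvg_sqrt_lim _ Q2c) _.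
rewrite (_ : (fun n => _) = X \o (fun n => sqrtY Q1 n x)); last first.
  by apply/funext => n /=; rewrite (sqrt_iter_intertwine n XQ).1.
by apply: (continuous_cvg _ (Xc _)); exact: cvg_sqrt_lim.
Qed.

Lemma contractive_continuous (R : realType) (H K : hilbertType R)
    (C : {linear H -> K}) : contractive_op C -> continuous C.
Proof.
move=> /contractive_sqn C1 x; apply/cvg_sqnP => e e0.
have /cvg_sqnP/(_ _ e0) : id @ x --> x by [].
by apply: filterS => y; apply: le_lt_trans; rewrite -linearB.
Qed.

(** Over the complex numbers a positive operator is self-adjoint: the imaginary
    part of the form vanishes at [x + i y]. *)
Lemma positive_sa (R : realType) (H : hilbertType R) (D : {linear H -> H}) :
  (forall x, 0 <= inner (D x) x) ->
  forall x y, rinner (D x) y = rinner x (D y).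
Proof.
move=> D0 x y; rewrite [RHS]rinnerC; have D_im z : complex.Im (inner (D z) z) = 0.
  by have := D0 z; rewrite lecE /= => /andP[/eqP].
have := D_im (x + 'i%C *: y); rewrite linearD linearZ/=.
rewrite !(innerDl, innerDr, innerZl, innerZr).
have := D_im x; have := D_im y; rewrite /rinner.
move: (inner (D x) x) (inner (D y) y) (inner (D x) y) (inner (D y) x).
move=> [a a'] [b b'] [c c'] [d d'] /=; lra.
Qed.

Lemma sa_inner (R : realType) (H : hilbertType R) (D : {linear H -> H}) :
  (forall x y, rinner (D x) y = rinner x (D y)) ->
  forall x y, inner (D x) y = inner x (D y).
Proof.
move=> Dsa x y; apply: (@inner_of_rinner _ _ (fun x => inner (D x) y)) => z.
  by rewrite linearZ innerZl.
exact: Dsa.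
Qed.

(** Minimality of the form at [y], tested along the direction [D y]. *)
Lemma positive_null (R : realType) (H : hilbertType R) (D : {linear H -> H}) :
  (forall x y, rinner (D x) y = rinner x (D y)) ->
  (forall x, 0 <= rinner (D x) x) ->
  forall y, rinner (D y) y = 0 -> D y = 0.
Proof.
move=> Dsa D0 y y0; apply: sqn_eq0.
set b := sqn (D y); set c := rinner (D (D y)) (D y).
have h (s : R) : 0 <= s ^+ 2 * c - 2 * s * b.
  have := D0 (y - s%:C%C *: D y).
  rewrite linearB linearZ/= !(rinnerBl, rinnerBr, rinnerZl, rinnerZr) y0.
  rewrite (Dsa (D y) y) -/c -[rinner (D y) (D y)]/b.
  by move=> /le_trans; apply; rewrite le_eqVlt; apply/orP; left; apply/eqP; ring.
have c0 : 0 <= c := D0 _.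
have c1 : 0 < c + 1 by rewrite ltr_wpDl.
have := h (b / (c + 1)).
have := sqn_ge0 (D y); rewrite -/b => b0.
set t := b / (c + 1) => ht.
have bt : b = t * (c + 1) by rewrite /t mulfVK// gt_eqF.
suff t0 : t = 0 by rewrite bt t0 mul0r.
move: ht; rewrite bt => ht; apply/eqP; rewrite -sqrf_eq0 eq_le sqr_ge0 andbT; nra.
Qed.

(** * Defect operators *)

(** Uniqueness: a positive root [D] of [1 - Q] commutes with [Q], hence with the
    root [E] obtained by iteration.  For y = (D - E) x this gives
    <D y, y> + <E y, y> = <(D^2 - E^2) x, y> = 0, so D y = E y = 0 and
    |y|^2 = <x, (D - E) y> = 0. *)
Section DefectOperator.
Variables (R : realType) (H K : hilbertType R) (C : {linear H -> K}).
Hypothesis C1 : contractive_op C.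

Let Q : {linear H -> H} := adj C \o C.

Let Q1 : contractive_op Q.
Proof.
move=> x; apply: le_trans (C1 x); exact: adj_contractive.
Qed.

Let Qsa x y : rinner (Q x) y = rinner x (Q y).
Proof. by rewrite /= -rinner_adjr// rinner_adj. Qed.

Let E_lin : linear (fun x => x - sqrt_lim Q x).
Proof.
by move=> a x y; rewrite (linear_sqrt_lim Q1) scalerBr opprD addrACA.
Qed.

Let E_sa x y : rinner (x - sqrt_lim Q x) y = rinner x (y - sqrt_lim Q y).
Proof. by rewrite rinnerBl rinnerBr sqrt_lim_sa. Qed.

Let E_ge0 x : 0 <= rinner (x - sqrt_lim Q x) x.
Proof.
rewrite rinnerBl; have := rinner_cs (sqrt_lim Q x) x.
have := sqn_sqrt_lim_le x Q1; rewrite -[rinner x x]/(sqn x).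
have := sqn_ge0 x; have := sqn_ge0 (sqrt_lim Q x).
move: (rinner _ _) (sqn _) (sqn _) => a b c b0 c0 bc abc.
rewrite subr_ge0; apply: le_trans (ler_norm _) _.
rewrite -(@ler_pXn2r _ 2)// ?nnegrE ?normr_ge0// real_normK ?num_real//.
by apply: le_trans abc _; rewrite expr2 ler_wpM2r.
Qed.

Let E_sq x : let E z := z - sqrt_lim Q z in E (E x) = x - Q x.
Proof.
have [Y eY] := linear_funP (linear_sqrt_lim Q1).
have := sqrt_lim_fix x Q1; rewrite /= eY linearB/= => fx.
have {}fx : Y x + Y x = adj C (C x) + Y (Y x).
  rewrite {1 2}fx -scalerDl -rmorphD/= (_ : 2^-1 + 2^-1 = 1 :> R) ?scale1r//.
  by field.
by rewrite -addrA -opprD addrA fx addrK.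
Qed.

Let E_pos x : 0 <= inner (x - sqrt_lim Q x) x.
Proof.
have [E eE] := linear_funP E_lin.
have EE z : E z = z - sqrt_lim Q z by rewrite -eE.
have Esa u v : rinner (E u) v = rinner u (E v) by rewrite !EE E_sa.
have := innerC (E x) x; rewrite -(sa_inner Esa) => /(congr1 (@complex.Im _)).
have := E_ge0 x; rewrite /rinner -EE.
case: (inner (E x) x) => a b /= a0 b0; rewrite lecE /= a0 andbT.
by apply/eqP; lra.
Qed.

Let E_unique (D : {linear H -> H}) : positive_op D ->
  (forall x, D (D x) = x - adj C (C x)) -> forall x, D x = x - sqrt_lim Q x.
Proof.
move=> [Dc D0] D2 x.
have Dsa := positive_sa D0.
have D0r z : 0 <= rinner (D z) z.
  by have := D0 z; rewrite lecE => /andP[_].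
have [E eE] := linear_funP E_lin.
have EE z : E z = z - sqrt_lim Q z by rewrite -eE.
have DQ z : D (Q z) = Q (D z).
  have -> : Q z = z - D (D z) by rewrite D2 opprB addrC subrK.
  by rewrite linearB/= (D2 (D z)) opprB addrC subrK.
have DE z : D (E z) = E (D z).
  by rewrite !EE linearB (sqrt_lim_intertwine Dc Q1 Q1 DQ).
have E2 z : E (E z) = D (D z) by rewrite D2 !EE; exact: E_sq.
rewrite -EE; set y := D x - E x.
have Esa u v : rinner (E u) v = rinner u (E v) by rewrite !EE E_sa.
have E0r z : 0 <= rinner (E z) z by rewrite !EE E_ge0.
have : rinner (D y) y + rinner (E y) y = 0.
  rewrite -rinnerDl /y !linearB/= DE E2 addrA subrK subrr.
  by rewrite /rinner inner0l.
have := D0r y; have := E0r y => e0 d0 ed.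
have Dy : D y = 0 by apply: positive_null => //; lra.
have Ey : E y = 0 by apply: positive_null => //; lra.
apply/subr0_eq/sqn_eq0; rewrite -/y -[LHS]/(rinner y y) {1}/y.
by rewrite rinnerBl Dsa Esa Dy Ey subrr.
Qed.

Let defect_spec :
  positive_op (defect C) /\ forall x, defect C (defect C x) = x - adj C (C x).
Proof.
apply: (@the_linearP _ _ _
  [set D : {linear H -> H} | positive_op D /\ forall x, D (D x) = x - adj C (C x)]).
have [E eE] := linear_funP E_lin.
have EE z : E z = z - sqrt_lim Q z by rewrite -eE.
exists E; split=> [|x]; last by rewrite !EE; exact: E_sq.
split=> [x|x]; last by rewrite EE E_pos.
rewrite (_ : (E : H -> H) = fun z => z - sqrt_lim Q z); last by rewrite -eE.
apply: cvgB; first exact: cvg_id.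
have [Y eY] := linear_funP (linear_sqrt_lim Q1); rewrite eY.
apply: contractive_continuous; apply/contractive_sqn => z; rewrite -eY.
exact: sqn_sqrt_lim_le.
Qed.

Lemma defectE x : defect C x = x - sqrt_lim Q x.
Proof. by have [h1 h2] := defect_spec; exact: E_unique. Qed.

Lemma defect_unique (D : {linear H -> H}) : positive_op D ->
  (forall x, D (D x) = x - adj C (C x)) -> defect C = D :> (H -> H).
Proof. by move=> h1 h2; apply/funext => x; rewrite defectE (E_unique h1 h2). Qed.

Lemma defect_sq x : defect C (defect C x) = x - adj C (C x).
Proof. by have [_] := defect_spec. Qed.

Lemma defect_positive : positive_op (defect C).
Proof. by have [] := defect_spec. Qed.

Lemma rinner_defect x y : rinner (defect C x) y = rinner x (defect C y).
Proof. by rewrite !defectE E_sa. Qed.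

Lemma sqn_defect x : sqn (defect C x) = sqn x - sqn (C x).
Proof.
rewrite -[LHS]/(rinner _ _) rinner_defect defect_sq rinnerBr -rinner_adj//.
Qed.

Lemma defect_contractive : contractive_op (defect C).
Proof.
by apply/contractive_sqn => x; rewrite sqn_defect gerBl sqn_ge0.
Qed.

End DefectOperator.

Lemma defect_intertwine (R : realType) (H1 K1 H2 K2 : hilbertType R)
    (C1 : {linear H1 -> K1}) (C2 : {linear H2 -> K2}) (X : {linear H1 -> H2}) :
  contractive_op C1 -> contractive_op C2 -> continuous X ->
  (forall x, X (adj C1 (C1 x)) = adj C2 (C2 (X x))) ->
  forall x, X (defect C1 x) = defect C2 (X x).
Proof.
move=> c1 c2 Xc XQ x; rewrite !defectE// linearB; congr (_ - _).
apply: sqrt_lim_intertwine => //.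
- by move=> z; apply: le_trans (c1 z); exact: adj_contractive.
- by move=> z; apply: le_trans (c2 z); exact: adj_contractive.
Qed.

(** The relation T D_T = D_T' T with T' the adjoint; it is what makes the
    cross terms of the block operators cancel. *)
Lemma defect_comm (R : realType) (H K : hilbertType R) (C : {linear H -> K}) x :
  contractive_op C -> C (defect C x) = defect (adj C) (C x).
Proof.
move=> C1; have C1' := adj_contractive C1.
apply: defect_intertwine => //; first exact: contractive_continuous.
by move=> z; rewrite adjK.
Qed.

Lemma defect_comm_adj (R : realType) (H K : hilbertType R) (C : {linear H -> K}) y :
  contractive_op C -> defect C (adj C y) = adj C (defect (adj C) y).
Proof.
move=> C1; have C1' := adj_contractive C1.
by rewrite (defect_comm _ C1') adjK.
Qed.

(** * Amplification to the Fock space *)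

Lemma csum_ge0 (R : realType) (z : nat -> R[i]) :
  csum_cvg z -> (forall m, 0 <= z m) -> 0 <= csum z.
Proof.
move=> [cr ci] z0; rewrite lecE /csum/=.
have zr m : 0 <= complex.Re (z m) by have := z0 m; rewrite lecE => /andP[].
have zi m : complex.Im (z m) = 0 by have := z0 m; rewrite lecE => /andP[/eqP].
rewrite (_ : series (_ \o _) = fun=> 0); last first.
  by apply/funext => N; rewrite /series/= big1.
rewrite lim_cst// eqxx/=; apply: limr_ge => //.
by apply: nearW => N; rewrite /series/= sumr_ge0.
Qed.

Lemma csum_cvg0 (R : realType) : csum_cvg (fun=> 0 : R[i]) /\ csum (fun=> 0 : R[i]) = 0.
Proof. exact: (@csum_single R (fun=> 0) 0%N). Qed.

Lemma csum_sum (R : realType) (I : Type) (s : seq I) (z : I -> nat -> R[i]) :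
  (forall i, csum_cvg (z i)) ->
  csum_cvg (fun m => \sum_(i <- s) z i m) /\
  csum (fun m => \sum_(i <- s) z i m) = \sum_(i <- s) csum (z i).
Proof.
move=> cz; elim: s => [|i s [IHc IHs]].
  have [h1 h2] := csum_cvg0 R.
  by rewrite big_nil (_ : (fun m => _) = fun=> 0)//; apply/funext => m; rewrite big_nil.
have -> : (fun m => \sum_(j <- i :: s) z j m) =
    (fun m => 1 * z i m + \sum_(j <- s) z j m).
  by apply/funext => m; rewrite big_cons mul1r.
split; last by rewrite csumDZ// big_cons mul1r IHs.
move: IHc (cz i) => [r1 i1] [r2 i2]; split.
  rewrite (_ : _ \o _ = (@complex.Re _ \o z i) +
    (@complex.Re _ \o (fun m => \sum_(j <- s) z j m))).
    exact: is_cvg_seriesD.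
  by apply/funext => m /=; rewrite mul1r raddfD.
rewrite (_ : _ \o _ = (@complex.Im _ \o z i) +
  (@complex.Im _ \o (fun m => \sum_(j <- s) z j m))).
  exact: is_cvg_seriesD.
by apply/funext => m /=; rewrite mul1r raddfD.
Qed.

Lemma cvg_plevel (R : realType) (n : nat) (H : hilbertType R) (u : fock n H) :
  plevel (val u) @ \oo --> sqn u.
Proof.
rewrite /sqn inner_fock /csum /= plevelE.
by have [] := level_cvg u u; rewrite plevelE.
Qed.

Arguments cvg_plevel {R n H} u.

Lemma plevel_le_sqn (R : realType) (n : nat) (H : hilbertType R) (u : fock n H) N :
  plevel (val u) N <= sqn u.
Proof.
rewrite -(cvg_lim _ (cvg_plevel u))//; apply: nondecreasing_cvgn_le.
  exact: plevel_nd.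
by apply/cvg_ex; exists (sqn u); exact: cvg_plevel.
Qed.

Lemma sqn_le_plevel (R : realType) (n : nat) (H : hilbertType R) (u : fock n H) (M : R) :
  (forall N, plevel (val u) N <= M) -> sqn u <= M.
Proof.
move=> uM; rewrite -(cvg_lim _ (cvg_plevel u))//; apply: limr_le.
  by apply/cvg_ex; exists (sqn u); exact: cvg_plevel.
exact: nearW.
Qed.

Lemma fockext (R : realType) (n : nat) (H : hilbertType R) (u v : fock n H) :
  (forall w, val u w = val v w) -> u = v.
Proof. by move=> uv; apply/val_inj/funext. Qed.

(** [fock_map] is defined with a junk value for families that are not square
    summable; for contractions it acts coefficientwise. *)
Lemma val_fock_map (R : realType) (n : nat) (H K : hilbertType R) (f : H -> K)
    (u : fock n H) w : contractive_op f -> val (fock_map f u) w = f (val u w).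
Proof.
by move=> f1; rewrite (fock_mapE (M := 1))// => x; rewrite mul1r.
Qed.

Lemma fock_map_linear (R : realType) (n : nat) (H K : hilbertType R)
    (f : {linear H -> K}) : contractive_op f -> linear (@fock_map R n H K f).
Proof.
move=> f1 a u v; apply: fockext => w; rewrite val_fock_map//.
rewrite linearP -[RHS]/((a *: val (fock_map f u) + val (fock_map f v)) w).
rewrite -[RHS]/(a *: val (fock_map f u) w + val (fock_map f v) w).
by rewrite !val_fock_map// -linearP.
Qed.

Lemma fock_map_contractive (R : realType) (n : nat) (H K : hilbertType R)
    (f : H -> K) : contractive_op f -> contractive_op (@fock_map R n H K f).
Proof.
move=> f1; apply/contractive_sqn => u; apply: sqn_le_plevel => N.
apply: le_trans (plevel_le_sqn u N); rewrite /plevel.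
apply: ler_sum => m _; apply: ler_sum => w _; rewrite val_fock_map//.
exact: (contractive_sqn f).1.
Qed.

Lemma inner_fock_map (R : realType) (n : nat) (H K : hilbertType R)
    (f : {linear H -> K}) (u : fock n H) (v : fock n K) : contractive_op f ->
  inner (fock_map f u) v = inner u (fock_map (adj f) v).
Proof.
move=> f1; rewrite !inner_fock; congr csum; apply/funext => m; rewrite /level.
apply: eq_bigr => w _; rewrite !val_fock_map//; last exact: adj_contractive.
exact: adjP.
Qed.

Lemma adj_fock_map (R : realType) (n : nat) (H K : hilbertType R)
    (f : {linear H -> K}) : contractive_op f ->
  adj (@fock_map R n H K f) = fock_map (adj f) :> (fock n K -> fock n H).
Proof.
move=> f1; have [F eF] := linear_funP (fock_map_linear (n := n) (adj_contractive f1)).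
rewrite eF; apply: adj_unique => u v; rewrite -eF; exact: inner_fock_map.
Qed.

(** The right-hand side is positive and squares to the right operator, so
    uniqueness of positive roots applies. *)
Lemma defect_fock_map (R : realType) (n : nat) (H K : hilbertType R)
    (f : {linear H -> K}) : contractive_op f ->
  defect (@fock_map R n H K f) = fock_map (defect f) :> (fock n H -> fock n H).
Proof.
move=> f1; have D1 := defect_contractive f1.
have [G eG] := linear_funP (fock_map_linear (n := n) f1).
have [D eD] := linear_funP (fock_map_linear (n := n) D1).
have G1 : contractive_op G by rewrite -eG; exact: fock_map_contractive.
rewrite eG eD; apply: defect_unique => //; last first.
  move=> u; rewrite -eD -eG adj_fock_map//; apply: fockext => w.
  rewrite -[RHS]/(val u w - val (fock_map (adj f) (fock_map f u)) w).
  by rewrite !val_fock_map ?defect_sq//; exact: adj_contractive.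
split=> [|u].
  by apply: contractive_continuous; rewrite -eD; exact: fock_map_contractive.
rewrite -eD inner_fock; apply: csum_ge0; first exact: level_cvg.
move=> m; rewrite /level sumr_ge0// => w _; rewrite val_fock_map//.
exact: (defect_positive f1).2.
Qed.

(** A unitary change of the source space conjugates the defect operator.  It is
    used for [fock_unpow], which exchanges the direct sum of n copies with the
    Fock space construction. *)
Section UnitaryPrecomposition.
Variables (R : realType) (H H' K : hilbertType R).
Variables (U : {linear H' -> H}) (V : {linear H -> H'}) (G : {linear H -> K}).
Hypotheses (UK : cancel U V) (VK : cancel V U).
Hypothesis U_iso : forall x y, inner (U x) (U y) = inner x y.
Hypothesis G1 : contractive_op G.

Let U_sqn x : sqn (U x) = sqn x. Proof. by rewrite /sqn U_iso. Qed.

Let V_sqn x : sqn (V x) = sqn x. Proof. by rewrite -U_sqn VK. Qed.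

Let GU1 : contractive_op (G \o U).
Proof. by apply/contractive_sqn => x; rewrite -(U_sqn x); exact: (contractive_sqn G).1. Qed.

Lemma adj_unitary : adj (G \o U) = V \o adj G :> (K -> H').
Proof.
by apply: adj_unique => x y; rewrite [LHS](adjP G1) -[in LHS](VK (adj G y)) U_iso.
Qed.

Lemma defect_unitary : defect (G \o U) = V \o defect G \o U :> (H' -> H').
Proof.
apply: (@defect_unique _ _ _ (G \o U) GU1 (V \o (defect G \o U))) => //=; last first.
  by move=> x; rewrite adj_unitary/= VK defect_sq// linearB/= UK.
split=> [|x].
  apply: contractive_continuous; apply/contractive_sqn => x /=.
  by rewrite V_sqn -(U_sqn x); exact: (contractive_sqn _).1 (defect_contractive G1) _.
by rewrite /= -U_iso VK; exact: (defect_positive G1).2.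
Qed.

Lemma defect_adj_unitary : defect (adj (G \o U)) = defect (adj G) :> (K -> K).
Proof.
have G1' := adj_contractive G1.
apply: defect_unique; [exact: adj_contractive|exact: defect_positive|].
by move=> y; rewrite defect_sq// !adjK// adj_unitary/= VK.
Qed.

End UnitaryPrecomposition.

Lemma row_op_linear (R : realType) (n : nat) (H K : hilbertType R)
    (T : 'I_n -> {linear H -> K}) : linear (row_op T).
Proof.
move=> a x y; rewrite /row_op scaler_sumr -big_split/=; apply: eq_bigr => j _.
by rewrite !ffunE linearP.
Qed.

HB.instance Definition _ (R : realType) (n : nat) (H K : hilbertType R)
    (T : 'I_n -> {linear H -> K}) :=
  GRing.isLinear.Build R[i] (hpow 'I_n H) K *:%R (row_op T) (row_op_linear T).

Lemma sqn_hpow (R : realType) (I : finType) (H : hilbertType R) (x : hpow I H) :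
  sqn x = \sum_i sqn (x i).
Proof. by rewrite /sqn raddf_sum. Qed.

Lemma row_op_entry_contractive (R : realType) (n : nat) (H K : hilbertType R)
    (T : 'I_n -> {linear H -> K}) j :
  contractive_op (row_op T) -> contractive_op (T j).
Proof.
move=> /contractive_sqn T1; apply/contractive_sqn => h.
pose x : hpow 'I_n H := [ffun i => if i == j then h else 0].
have := T1 x; rewrite sqn_hpow /row_op (bigD1 j)//= ffunE eqxx.
rewrite big1 ?addr0 => [|i ij]; last by rewrite ffunE (negbTE ij) linear0.
rewrite (bigD1 j)//= ffunE eqxx big1 ?addr0// => i ij.
by rewrite ffunE (negbTE ij) sqn0.
Qed.

Definition fock_fiber (R : realType) (n : nat) (I : finType) (H : hilbertType R)
  (u : hpow I (fock n H)) (w : seq 'I_n) : hpow I H := [ffun j => val (u j) w].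

Definition fock_unpow (R : realType) (n : nat) (I : finType) (H : hilbertType R)
  (u : hpow I (fock n H)) : fock n (hpow I H) := fock_of (fock_fiber u).

Lemma val_fock_unpow (R : realType) (n : nat) (I : finType) (H : hilbertType R)
  (u : hpow I (fock n H)) w : val (fock_unpow u) w = fock_fiber u w.
Proof.
rewrite /fock_unpow fock_ofE//; apply/fockP; exists (\sum_i sqn (u i)) => N.
rewrite (_ : plevel _ N = \sum_i plevel (val (u i)) N).
  by apply: ler_sum => i _; exact: plevel_le_sqn.
rewrite /plevel exchange_big/=; apply: eq_bigr => m _.
rewrite exchange_big/=; apply: eq_bigr => w' _.
by rewrite sqn_hpow; apply: eq_bigr => i _; rewrite ffunE.
Qed.

Lemma hpow_proj_contractive (R : realType) (I : finType) (H : hilbertType R) (j : I) :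
  contractive_op (fun h : hpow I H => h j).
Proof.
apply/contractive_sqn => x; rewrite sqn_hpow (bigD1 j)//= lerDl.
by rewrite sumr_ge0// => i _; exact: sqn_ge0.
Qed.

Lemma val_fock_pow (R : realType) (n : nat) (I : finType) (H : hilbertType R)
    (u : fock n (hpow I H)) j w : val (fock_pow u j) w = val u w j.
Proof.
rewrite ffunE (val_fock_map (f := fun h : hpow I H => h j))//.
exact: hpow_proj_contractive.
Qed.

Lemma fock_powK (R : realType) (n : nat) (I : finType) (H : hilbertType R) :
  cancel (@fock_pow R n I H) (@fock_unpow R n I H).
Proof.
move=> u; apply: fockext => w; rewrite val_fock_unpow.
by apply/ffunP => j; rewrite ffunE val_fock_pow.
Qed.

Lemma fock_unpowK (R : realType) (n : nat) (I : finType) (H : hilbertType R) :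
  cancel (@fock_unpow R n I H) (@fock_pow R n I H).
Proof.
move=> u; apply/ffunP => j; apply: fockext => w.
by rewrite val_fock_pow val_fock_unpow ffunE.
Qed.

Lemma fock_unpow_linear (R : realType) (n : nat) (I : finType) (H : hilbertType R) :
  linear (@fock_unpow R n I H).
Proof.
move=> a u v; apply: fockext => w.
rewrite -[RHS]/(a *: val (fock_unpow u) w + val (fock_unpow v) w).
by rewrite !val_fock_unpow; apply/ffunP => j; rewrite !ffunE.
Qed.

Lemma fock_pow_linear (R : realType) (n : nat) (I : finType) (H : hilbertType R) :
  linear (@fock_pow R n I H).
Proof.
move=> a u v; apply: (can_inj (@fock_unpowK _ _ _ _)).
by rewrite fock_powK fock_unpow_linear !fock_powK.
Qed.

Lemma inner_fock_unpow (R : realType) (n : nat) (I : finType) (H : hilbertType R)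
    (u v : hpow I (fock n H)) :
  inner (fock_unpow u) (fock_unpow v) = inner u v.
Proof.
rewrite inner_fock -[RHS]/(\sum_i csum (level (val (u i)) (val (v i)))).
have [_ <-] := csum_sum (index_enum I) (fun i => level_cvg (u i) (v i)).
congr csum; apply/funext => m; rewrite /level [RHS]exchange_big; apply: eq_bigr => w _.
by rewrite !val_fock_unpow; apply: eq_bigr => i _; rewrite !ffunE.
Qed.

Lemma val_sum_fock (R : realType) (n : nat) (H : hilbertType R) (I : finType)
    (F : I -> fock n H) w : val (\sum_i F i) w = \sum_i val (F i) w.
Proof. by rewrite raddf_sum fct_sumE. Qed.

(** Reduces the ampliated row operator to the coefficientwise action of a
    single operator, up to the unitary [fock_unpow]. *)
Lemma amp_rowE (R : realType) (n : nat) (H : hilbertType R)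
    (T : 'I_n -> {linear H -> H}) : contractive_op (row_op T) ->
  amp_row T = fock_map (row_op T) \o @fock_unpow R n _ H.
Proof.
move=> T1; apply/funext => u; apply: fockext => w /=.
rewrite val_fock_map// val_fock_unpow /amp_row /row_op val_sum_fock.
apply: eq_bigr => j _; rewrite val_fock_map ?ffunE//.
exact: row_op_entry_contractive.
Qed.

(** * The system attached to a contraction *)

(** Conservation of energy: the cross terms cancel by [defect_comm_adj]. *)
Lemma colligation (R : realType) (H K : hilbertType R) (C : {linear H -> K})
    (u : H) (x : K) : contractive_op C ->
  sqn (- C u + defect (adj C) x) + sqn (defect C u + adj C x) = sqn u + sqn x.
Proof.
move=> C1; have C1' := adj_contractive C1.
rewrite !sqnDE sqnN !sqn_defect// rinnerNl rinner_defect//.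
by rewrite defect_comm_adj// -rinner_adj//; ring.
Qed.

(** The input-output relation of the system; the state [x] is an arbitrary
    function on words, which need not be square summable when [r] is 1. *)
Definition theta_rel (R : realType) (n : nat) (H : hilbertType R)
    (C : hpow 'I_n H -> H) (r : R) (f : seq 'I_n -> hpow 'I_n H)
    (g : seq 'I_n -> H) :=
  exists x : seq 'I_n -> H, [/\ x [::] = 0,
    forall w j, x (rcons w j) = r%:C%C *: (defect C (f w) + adj C (x w)) j &
    forall w, g w = - C (f w) + defect (adj C) (x w)].

(** Words grow at their end, hence the recursion on the reversed word. *)
Fixpoint theta_state (R : realType) (n : nat) (H : hilbertType R)
    (C : hpow 'I_n H -> H) (r : R) (f : seq 'I_n -> hpow 'I_n H)
    (w : seq 'I_n) : H :=
  if w is j :: w' then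
    r%:C%C *: (defect C (f (rev w')) + adj C (theta_state C r f w')) j
  else 0.

Lemma theta_rel_exists (R : realType) (n : nat) (H : hilbertType R)
    (C : hpow 'I_n H -> H) (r : R) (f : seq 'I_n -> hpow 'I_n H) :
  exists g, theta_rel C r f g.
Proof.
exists (fun w => - C (f w) + defect (adj C) (theta_state C r f (rev w))).
exists (fun w => theta_state C r f (rev w)); split=> // w j.
by rewrite rev_rcons /= revK.
Qed.

Lemma theta_relB (R : realType) (n : nat) (H : hilbertType R)
    (C : {linear hpow 'I_n H -> H}) (r : R) (f f' : seq 'I_n -> hpow 'I_n H) g g' :
  theta_rel C r f g -> theta_rel C r f' g' -> theta_rel C r (f - f') (g - g').
Proof.
move=> [x [x0 xS xg]] [y [y0 yS yg]]; exists (x - y); split.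
- by rewrite -[LHS]/(x [::] - y [::]) x0 y0 subrr.
- move=> w j; rewrite -[LHS]/(x (rcons w j) - y (rcons w j)) xS yS.
  rewrite -[(f - f') w]/(f w - f' w) -[(x - y) w]/(x w - y w) !linearB/=.
  by rewrite !ffunE -scalerBr opprD addrACA.
- move=> w; rewrite -[LHS]/(g w - g' w) xg yg.
  rewrite -[(f - f') w]/(f w - f' w) -[(x - y) w]/(x w - y w) !linearB/=.
  by rewrite opprD addrACA.
Qed.

(** Intertwines right creation operators with their multiples by [r], which
    moves the parameter of the system from 1 to [r]. *)
Definition dilate (R : realType) (n : nat) (H : hilbertType R) (r : R)
  (f : seq 'I_n -> H) (w : seq 'I_n) : H := (r ^+ size w)%:C%C *: f w.

Lemma theta_rel_dilate (R : realType) (n : nat) (H : hilbertType R)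
    (C : {linear hpow 'I_n H -> H}) (r : R) (f : seq 'I_n -> hpow 'I_n H) g :
  theta_rel C 1 f g -> theta_rel C r (dilate r f) (dilate r g).
Proof.
move=> [x [x0 xS xg]]; exists (dilate r x); split.
- by rewrite /dilate x0 scaler0.
- move=> w j; rewrite /dilate xS size_rcons !linearZ/= -scalerDr rmorph1 scale1r.
  by rewrite !ffunE scalerA exprS rmorphM.
- by move=> w; rewrite /dilate xg !linearZ/= scalerDr scalerN.
Qed.

Lemma sum_rcons_tuple (R : realType) (n m : nat) (F : seq 'I_n -> R) :
  \sum_(w : m.+1.-tuple 'I_n) F w =
  \sum_(w : m.-tuple 'I_n) \sum_(j : 'I_n) F (rcons w j).
Proof.
rewrite pair_bigA/=.
rewrite (reindex (fun p : m.-tuple 'I_n * 'I_n => [tuple of rcons p.1 p.2]))//=.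
exists (fun w : m.+1.-tuple 'I_n =>
  ([tuple of belast (thead w) (behead w)], last (thead w) (behead w))).
  move=> [t j] _ /=; congr pair; last first.
    by case: t => -[|i s] //= h; rewrite /thead (tnth_nth i)/= last_rcons.
  apply/val_inj; case: t => -[|i s] //= h.
  by rewrite /thead (tnth_nth i)/= belast_rcons.
move=> w _; apply/val_inj; case/tupleP: w => i w /=.
by rewrite theadE -lastI.
Qed.

Lemma plevel_shift (R : realType) (n : nat) (H : hilbertType R) (r : R)
    (x : seq 'I_n -> H) (z : seq 'I_n -> hpow 'I_n H) N :
  x [::] = 0 -> (forall w j, x (rcons w j) = r%:C%C *: z w j) ->
  plevel x N.+1 = r ^+ 2 * plevel z N.
Proof.
move=> x0 xS; rewrite {1}/plevel big_ord_recl big1 ?add0r => [|w _]; last first.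
  by rewrite tuple0 /= x0 sqn0.
rewrite /plevel mulr_sumr; apply: eq_bigr => m _.
rewrite (sum_rcons_tuple _ (fun w => sqn (x w))) mulr_sumr.
apply: eq_bigr => w _; rewrite sqn_hpow mulr_sumr; apply: eq_bigr => j _.
by rewrite xS sqnZr.
Qed.

(** Summing [colligation] over the words of length less than [N]; the sum for the
    shifted state is rewritten by [plevel_shift]. *)
Lemma theta_energy (R : realType) (n : nat) (H : hilbertType R)
    (C : {linear hpow 'I_n H -> H}) (r : R) (f : seq 'I_n -> hpow 'I_n H) g x N :
  contractive_op C -> x [::] = 0 ->
  (forall w j, x (rcons w j) = r%:C%C *: (defect C (f w) + adj C (x w)) j) ->
  (forall w, g w = - C (f w) + defect (adj C) (x w)) ->
  plevel g N + plevel x N.+1 +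
    (1 - r ^+ 2) * plevel (fun w => defect C (f w) + adj C (x w)) N =
  plevel f N + plevel x N.
Proof.
move=> C1 x0 xS xg; rewrite (plevel_shift N x0 xS) -addrA -mulrDl addrC.
rewrite [_ ^+ 2 + _]addrC subrK mul1r addrC.
rewrite /plevel -!big_split/=; apply: eq_bigr => m _.
rewrite -!big_split/=; apply: eq_bigr => w _.
by rewrite xg colligation.
Qed.

Lemma plevel_ge0 (R : realType) (n : nat) (H : hilbertType R)
  (u : seq 'I_n -> H) N : 0 <= plevel u N.
Proof. by rewrite /plevel; do 2!(apply: sumr_ge0 => ? _); exact: sqn_ge0. Qed.

(** Valid up to [r = 1]: only partial sums are compared, so the state may have
    infinite norm. *)
Lemma theta_rel_le (R : realType) (n : nat) (H : hilbertType R)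
    (C : {linear hpow 'I_n H -> H}) (r : R) (f : seq 'I_n -> hpow 'I_n H) g N :
  contractive_op C -> 0 <= r <= 1 -> theta_rel C r f g ->
  plevel g N <= plevel f N.
Proof.
move=> C1 /andP[r0 r1] [x [x0 xS xg]]; have := theta_energy N C1 x0 xS xg.
have := plevel_nd x (leqnSn N).
set z := fun w => _ + _.
have : 0 <= (1 - r ^+ 2) * plevel z N.
  by rewrite mulr_ge0 ?plevel_ge0// subr_ge0 expr_le1.
lra.
Qed.

(** For [r < 1] the energy balance leaves a positive multiple of the energy of the
    state on the left, which bounds it by the energy of the input. *)
Lemma theta_state_fock (R : realType) (n : nat) (H : hilbertType R)
    (C : {linear hpow 'I_n H -> H}) (r : R) (f : fock n (hpow 'I_n H)) x :
  contractive_op C -> 0 <= r < 1 -> x [::] = 0 ->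
  (forall w j, x (rcons w j) = r%:C%C *: (defect C (val f w) + adj C (x w)) j) ->
  fock_pred x.
Proof.
move=> C1 /andP[r0 r1] x0 xS; apply/fockP.
have r2 : 0 < 1 - r ^+ 2 by rewrite subr_gt0 expr_lt1.
exists (r ^+ 2 * (sqn f / (1 - r ^+ 2))) => N.
have := theta_energy N C1 x0 xS (fun w => erefl).
set z := fun w => defect C _ + _; set g := fun w => _ + _ => e.
apply: le_trans (plevel_nd x (leqnSn N)) _; rewrite (plevel_shift N x0 xS) -/z.
apply: ler_wpM2l; first exact: exprn_ge0.
rewrite ler_pdivlMr// mulrC.
have := plevel_nd x (leqnSn N); have := plevel_ge0 g N; have := plevel_le_sqn f N.
by move: e; lra.
Qed.

(** * The characteristic function as a radial limit *)

Lemma creation_row_nil (R : realType) (n : nat) (H : hilbertType R)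
    (u : hpow 'I_n (fock n H)) : val (creation_row u) [::] = 0.
Proof.
rewrite /creation_row /row_op val_sum_fock big1// => j _.
by rewrite rcreationE.
Qed.

Lemma creation_row_rcons (R : realType) (n : nat) (H : hilbertType R)
    (u : hpow 'I_n (fock n H)) w j :
  val (creation_row u) (rcons w j) = val (u j) w.
Proof.
have rcE i : val (rcreation i (u i)) (rcons w j) = if j == i then val (u i) w else 0.
  by rewrite rcreationE; case: w => [|k w] //=; rewrite last_rcons belast_rcons.
rewrite /creation_row /row_op val_sum_fock (bigD1 j)//= rcE eqxx.
by rewrite big1 ?addr0// => i; rewrite rcE eq_sym => /negbTE ->.
Qed.

Lemma op_inv_eq (R : realType) (H K : hilbertType R) (F : H -> K) x y :
  injective F -> F x = y -> op_inv F y = x.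
Proof.
move=> Finj <-; rewrite /op_inv pinvKV// ?inE//.
by move=> a b _ _; exact: Finj.
Qed.

(** The resolvent applied to the input is the state: injectivity of
    [v - r R T' v] is an induction on words, and the state is a preimage by its
    recursion. *)
Lemma Theta_rE (R : realType) (n : nat) (H : hilbertType R)
    (T : 'I_n -> {linear H -> H}) (r : R) (f : fock n (hpow 'I_n H)) (g : fock n H) :
  contractive_op (row_op T) -> 0 <= r < 1 ->
  theta_rel (row_op T) r (val f) (val g) ->
  Theta_r T r (fock_pow f) = g.
Proof.
move=> T1 r01 [x [x0 xS xg]]; have fx := theta_state_fock T1 r01 x0 xS.
have T1' := adj_contractive T1.
pose X : fock n H := fock_of x; have vX w : val X w = x w by rewrite fock_ofE.
have [G eG] := linear_funP (fock_map_linear (n := n) T1).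
have [U eU] := linear_funP (@fock_unpow_linear R n 'I_n H).
have [V eV] := linear_funP (@fock_pow_linear R n 'I_n H).
have UK : cancel U V by rewrite -eU -eV; exact: fock_unpowK.
have VK : cancel V U by rewrite -eU -eV; exact: fock_powK.
have U_iso a b : inner (U a) (U b) = inner a b by rewrite -eU inner_fock_unpow.
have G1 : contractive_op G by rewrite -eG; exact: fock_map_contractive.
have eA : amp_row T = G \o U by rewrite amp_rowE// eG eU.
have aA v : adj (amp_row T) v = fock_pow (fock_map (adj (row_op T)) v).
  by rewrite eA (adj_unitary VK U_iso G1) -eV -eG adj_fock_map.
have dA u : defect (amp_row T) (fock_pow u) =
    fock_pow (fock_map (defect (row_op T)) u).
  by rewrite eA (defect_unitary UK VK U_iso G1)/= -eU fock_powK -eV -eG defect_fock_map.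
have dA' : defect (adj (amp_row T)) = fock_map (defect (adj (row_op T))) :> (_ -> _).
  by rewrite eA (defect_adj_unitary VK U_iso G1) -eG adj_fock_map// defect_fock_map.
pose F (v : fock n H) := v - r%:C%C *: creation_row (adj (amp_row T) v).
have F_nil v : val (F v) [::] = val v [::].
  rewrite -[LHS]/(val v [::] - r%:C%C *: val (creation_row _) [::]).
  by rewrite creation_row_nil scaler0 subr0.
have F_rcons v w j : val (F v) (rcons w j) =
    val v (rcons w j) - r%:C%C *: adj (row_op T) (val v w) j.
  rewrite -[LHS]/(_ - r%:C%C *: val (creation_row _) (rcons w j)).
  by rewrite creation_row_rcons aA/= val_fock_pow val_fock_map.
have F_inj : injective F.
  move=> u v uv; apply: fockext; elim/last_ind => [|w j IH].
    by rewrite -[LHS]F_nil uv F_nil.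
  have e := congr1 (fun z : fock n H => val z (rcons w j)) uv.
  have {}e := etrans (esym (F_rcons u w j)) (etrans e (F_rcons v w j)).
  by rewrite IH in e; exact: addIr e.
have FX : F X = r%:C%C *: creation_row (defect (amp_row T) (fock_pow f)).
  apply: fockext; elim/last_ind => [|w j _].
    rewrite F_nil -[RHS]/(r%:C%C *: val (creation_row _) [::]) creation_row_nil.
    by rewrite vX x0 scaler0.
  rewrite F_rcons -[RHS]/(r%:C%C *: val (creation_row _) (rcons w j)).
  rewrite creation_row_rcons dA val_fock_pow val_fock_map; last exact: defect_contractive.
  by rewrite !vX xS ffunE scalerDr addrK.
rewrite /Theta_r (op_inv_eq F_inj FX); apply: fockext => w.
rewrite dA' -[LHS]/(- val (amp_row T (fock_pow f)) w + val (fock_map _ X) w).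
rewrite val_fock_map; last exact: defect_contractive.
rewrite amp_rowE//= fock_powK val_fock_map// vX xg//.
Qed.

Lemma plevelS (R : realType) (n : nat) (H : hilbertType R) (u : seq 'I_n -> H) N :
  plevel u N.+1 = plevel u N + \sum_(w : N.-tuple 'I_n) sqn (u w).
Proof. by rewrite /plevel big_ord_recr. Qed.

Lemma plevel_dilate_le (R : realType) (n : nat) (H : hilbertType R)
    (u : seq 'I_n -> H) (r : R) (M N : nat) : 0 <= r <= 1 -> (M <= N)%N ->
  plevel (u - dilate r u) N <=
  (1 - r ^+ M) ^+ 2 * plevel u M + (plevel u N - plevel u M).
Proof.
move=> /andP[r0 r1].
have sE m (w : m.-tuple 'I_n) :
    sqn ((u - dilate r u) w) = (1 - r ^+ m) ^+ 2 * sqn (u w).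
  rewrite -[(u - dilate r u) w]/(u w - (r ^+ size w)%:C%C *: u w) size_tuple.
  rewrite (_ : _ - _ = (1 - r ^+ m)%:C%C *: u w) ?sqnZr//.
  by rewrite rmorphB rmorph1 scalerBl scale1r.
move=> /subnK <-; elim: (N - M)%N => [|k IH].
  rewrite add0n subrr addr0 /plevel mulr_sumr; apply: ler_sum => m _.
  rewrite mulr_sumr; apply: ler_sum => w _; rewrite sE ler_wpM2r ?sqn_ge0//.
  have h1 : r ^+ m <= 1 by rewrite exprn_ile1.
  have h2 : r ^+ M <= r ^+ m by rewrite ler_wiXn2l// ltnW.
  by rewrite ler_pXn2r// ?nnegrE ?subr_ge0// ?lerD2l ?lerN2// (le_trans h2).
rewrite addSn !plevelS.
apply: (le_trans (lerD IH (_ : _ <= \sum_(w : (k + M).-tuple 'I_n) sqn (u w)))).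
  apply: ler_sum => w _; rewrite sE ler_piMl ?sqn_ge0// expr_le1// ?subr_ge0.
    by rewrite gerBl exprn_ge0.
  by rewrite exprn_ile1.
lra.
Qed.

(** Strong convergence to the identity, stated on partial sums so that the
    dilated family need not be packed as an element of the Fock space. *)
Lemma cvg_dilate (R : realType) (n : nat) (H : hilbertType R) (u : fock n H) (e : R) :
  0 < e ->
  \forall r \near (1 : R)^'-, forall N, plevel (val u - dilate r (val u)) N <= e.
Proof.
move=> e0; have e2 : 0 < e / 2 by rewrite divr_gt0.
(* M splits off a tail of energy below e / 2; the head is handled by continuity. *)
have /cvgrPdist_lt/(_ _ e2)[M _ hM] := cvg_plevel u.
have cr : (1 - r ^+ M) ^+ 2 * sqn u @[r --> (1 : R)^'-] --> (0 : R).
  rewrite [X in _ --> X](_ : _ = (1 - 1 ^+ M) ^+ 2 * sqn u); last first.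
    by rewrite expr1n subrr expr0n mul0r.
  apply: cvg_at_left_filter; apply: cvgMl.
  apply: (@continuous_comp _ _ _ (fun r : R => 1 - r ^+ M) (fun x : R => x ^+ 2)).
    by apply: cvgB; [exact: cvg_cst|exact: exprn_continuous].
  exact: exprn_continuous.
move/cvgrPdist_lt : cr => /(_ _ e2) cr.
near=> r => N.
have r0 : 0 <= r by near: r; exact: nbhs_left_ge.
have r1 : r <= 1 by near: r; exact: nbhs_left_le.
have : (1 - r ^+ M) ^+ 2 * sqn u < e / 2.
  by near: r; apply: filterS cr => r; rewrite sub0r normrN; apply: le_lt_trans; exact: ler_norm.
move=> rM.
apply: le_trans (plevel_nd _ (leq_maxr M N)) _.
have r01 : 0 <= r <= 1 by rewrite r0.
apply: le_trans (plevel_dilate_le _ r01 (leq_maxl M N)) _; move: rM.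
have := hM M (leqnn M); rewrite /= ger0_norm ?subr_ge0 ?plevel_le_sqn//.
have := plevel_le_sqn u (maxn M N); have := plevel_le_sqn u M.
have : 0 <= (1 - r ^+ M) ^+ 2 by rewrite sqr_ge0.
move: ((1 - r ^+ M) ^+ 2) (sqn u) (plevel _ M) (plevel _ (maxn M N)) => a b c d a0 bc bd h1 h2.
have : a * c <= a * b by rewrite ler_wpM2l.
lra.
Unshelve. all: by end_near. Qed.

Lemma theta_rel_fock (R : realType) (n : nat) (H : hilbertType R)
    (C : {linear hpow 'I_n H -> H}) (r : R) (f : fock n (hpow 'I_n H)) g :
  contractive_op C -> 0 <= r <= 1 -> theta_rel C r (val f) g -> fock_pred g.
Proof.
move=> C1 r01 fg; apply/fockP; exists (sqn f) => N.
exact: le_trans (theta_rel_le N C1 r01 fg) (plevel_le_sqn f N).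
Qed.

(** [Theta_r f - g] is [Theta_r (f - dilate r f)] plus [dilate r g - g], because
    [Theta_r] sends [dilate r f] to [dilate r g]; both terms tend to 0. *)
Lemma cvg_Theta_r (R : realType) (n : nat) (H : hilbertType R)
    (T : 'I_n -> {linear H -> H}) (f : fock n (hpow 'I_n H)) (g : fock n H) :
  contractive_op (row_op T) -> theta_rel (row_op T) 1 (val f) (val g) ->
  Theta_r T r (fock_pow f) @[r --> (1 : R)^'-] --> g.
Proof.
move=> T1 fg; apply/cvg_sqnP => e e0; have e8 : 0 < e / 8 by rewrite divr_gt0.
(* Each of the two terms counts twice in [sqnD_le]: 2 (e / 8) + 2 (e / 8) = e / 2. *)
near=> r.
have r0 : 0 <= r by near: r; exact: nbhs_left_ge.
have r1 : r < 1 by near: r; exact: nbhs_left_lt.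
have r01 : 0 <= r <= 1 by rewrite r0 ltW.
have fr N : plevel (val f - dilate r (val f)) N <= e / 8.
  by move: N; near: r; exact: cvg_dilate.
have gr N : plevel (val g - dilate r (val g)) N <= e / 8.
  by move: N; near: r; exact: cvg_dilate.
have [t ft] := theta_rel_exists (row_op T) r (val f).
have tF := theta_rel_fock T1 r01 ft.
pose t' : fock n H := Sub t tF.
have -> : Theta_r T r (fock_pow f) = t' by apply: Theta_rE; rewrite ?r0.
have tr N : plevel (t - dilate r (val g)) N <= e / 8.
  exact: le_trans (theta_rel_le N T1 r01 (theta_relB ft (theta_rel_dilate r fg))) (fr N).
apply: (@le_lt_trans _ _ (e / 2)); last by rewrite ltr_pdivrMr// ltr_pMr// ltr1n.
apply: sqn_le_plevel => N.
have -> : val (t' - g) = (t - dilate r (val g)) + - (val g - dilate r (val g)).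
  by rewrite raddfB/= opprB addrA subrK.
apply: le_trans (plevelD _ _ N) _.
have -> : plevel (- (val g - dilate r (val g))) N = plevel (val g - dilate r (val g)) N.
  by rewrite /plevel; do 2!(apply: eq_bigr => ? _); exact: sqnN.
have := tr N; have := gr N; lra.
Unshelve. all: by end_near. Qed.

Lemma subspace_incl_contractive (R : realType) (H : hilbertType R) (S : csubspace H) :
  contractive_op (@subspace_incl R H S).
Proof. by apply/contractive_sqn. Qed.

Lemma charfunE (R : realType) (n : nat) (H : hilbertType R)
    (T : 'I_n -> {linear H -> H}) (f : fock n (defect_space (row_op T)))
    (g : fock n (defect_space (adj (row_op T)))) :
  contractive_op (row_op T) ->
  theta_rel (row_op T) 1 (fun w => subspace_incl (val f w))
    (fun w => subspace_incl (val g w)) ->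
  charfun T f = g.
Proof.
move=> T1 fg.
have vincl (S : csubspace (hpow 'I_n H)) (u : fock n (subspace_of S)) :
    val (fock_map (@subspace_incl _ _ S) u) = fun w => subspace_incl (val u w).
  by apply/funext => w; rewrite val_fock_map//; exact: subspace_incl_contractive.
have vincl' (S : csubspace H) (u : fock n (subspace_of S)) :
    val (fock_map (@subspace_incl _ _ S) u) = fun w => subspace_incl (val u w).
  by apply/funext => w; rewrite val_fock_map//; exact: subspace_incl_contractive.
have lim_g : Theta_r T r (fock_pow (fock_map (@subspace_incl _ _ _) f))
    @[r --> (1 : R)^'-] --> fock_map (@subspace_incl _ _ _) g.
  by apply: cvg_Theta_r => //; rewrite vincl vincl'.
rewrite /charfun; set P := (X in xget 0 X).
have : P (xget 0 P) by apply: xgetPex; exists g.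
move=> /= /(hilbert_cvg_unique lim_g) /(congr1 val); rewrite !vincl' => eq_g.
apply: fockext => w; apply: val_inj.
exact/esym/(congr1 (fun h => h w) eq_g).
Qed.

(** * Direct sums, defect spaces and unitaries *)

Lemma rinner_hsum (R : realType) (H K : hilbertType R) (x y : hsum H K) :
  rinner x y = rinner x.1 y.1 + rinner x.2 y.2.
Proof. by rewrite /rinner -raddfD. Qed.

Lemma sqn_hsum (R : realType) (H K : hilbertType R) (x : hsum H K) :
  sqn x = sqn x.1 + sqn x.2.
Proof. exact: rinner_hsum. Qed.

Lemma rinner_hpow (R : realType) (I : finType) (H : hilbertType R)
    (x y : hpow I H) :
  rinner x y = \sum_i rinner (x i) (y i).
Proof. by rewrite /rinner raddf_sum. Qed.

Lemma rinner_incl (R : realType) (H : hilbertType R) (S : csubspace H)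
    (x y : subspace_of S) :
  rinner (subspace_incl x) (subspace_incl y) = rinner x y.
Proof. by []. Qed.

Definition hpow_join (R : realType) (I : finType) (H K : hilbertType R)
    (x : hsum (hpow I H) (hpow I K)) : hpow I (hsum H K) :=
  [ffun j => (x.1 j, x.2 j)].

Lemma hpow_joinK (R : realType) (I : finType) (H K : hilbertType R)
    (x : hsum (hpow I H) (hpow I K)) : hpow_split (hpow_join x) = x.
Proof. by case: x => u v; congr pair; apply/ffunP => j; rewrite !ffunE. Qed.

Lemma rinner_split (R : realType) (I : finType) (H K : hilbertType R)
    (x y : hpow I (hsum H K)) :
  rinner (hpow_split x) (hpow_split y) = rinner x y.
Proof.
rewrite rinner_hsum !rinner_hpow -big_split; apply: eq_bigr => j _.
by rewrite rinner_hsum !ffunE.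
Qed.

Lemma defect_space_dense (R : realType) (H K : hilbertType R) (C : H -> K)
    (x : defect_space C) (e : R) :
  0 < e -> exists h, sqn (subspace_incl x - defect C h) < e.
Proof.
move=> e0; have := valP x; rewrite /csubspace_pred inE => clx.
have /clx[_ [[h _ <-] xh]] : nbhs (val x) [set y | sqn (y - val x) < e].
  have /cvg_sqnP/(_ _ e0) : id @ val x --> val x by [].
  by [].
by exists h; rewrite -sqnN opprB.
Qed.

(** A vector of the defect space orthogonal to the range is orthogonal to its own
    approximations from the range. *)
Lemma defect_space_eq0 (R : realType) (H K : hilbertType R) (C : H -> K)
    (x : defect_space C) :
  (forall h, rinner (subspace_incl x) (defect C h) = 0) -> x = 0.
Proof.
move=> x0; apply: sqn_eq0; apply/eqP/negP => /negP xn0.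
have sx : 0 < sqn x by rewrite lt_neqAle eq_sym xn0 sqn_ge0.
have [h xh] := defect_space_dense x sx.
have := rinner_cs (subspace_incl x) (subspace_incl x - defect C h).
rewrite rinnerBr x0 subr0 -[rinner _ _]/(sqn x) expr2 ler_pM2l//.
by rewrite leNgt xh.
Qed.

(** On the range this is [defect_comm]; continuity extends it to the closure. *)
Lemma defect_space_map (R : realType) (H K : hilbertType R) (C : {linear H -> K})
    (x : defect_space C) : contractive_op C ->
  csubspace_pred (defect_subspace (adj C)) (C (subspace_incl x)).
Proof.
move=> C1; rewrite /csubspace_pred inE => B nB.
have := valP x; rewrite /csubspace_pred inE => clx.
have /clx[_ [[h _ <-] xh]] := contractive_continuous C1 nB.
exists (C (defect C h)); split=> //; exists (C h) => //.
by rewrite defect_comm.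
Qed.

Lemma corestr_map (R : realType) (H K : hilbertType R) (C : {linear H -> K})
    (x : defect_space C) : contractive_op C ->
  subspace_incl (corestr (defect_subspace (adj C)) (C (subspace_incl x))) =
  C (subspace_incl x).
Proof. by move=> C1; rewrite /subspace_incl insubdK//; exact: defect_space_map. Qed.

Lemma subspace_inclD (R : realType) (H : hilbertType R) (S : csubspace H)
  (x y : subspace_of S) : subspace_incl (x + y) = subspace_incl x + subspace_incl y.
Proof. exact: raddfD. Qed.

Lemma subspace_inclN (R : realType) (H : hilbertType R) (S : csubspace H)
  (x : subspace_of S) : subspace_incl (- x) = - subspace_incl x.
Proof. exact: raddfN. Qed.

Lemma subspace_incl_inj (R : realType) (H : hilbertType R) (S : csubspace H) :
  injective (@subspace_incl R H S).
Proof. exact: val_inj. Qed.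

Lemma rinner_defect_to (R : realType) (H K : hilbertType R) (C : {linear H -> K})
    (y : defect_space C) x : contractive_op C ->
  rinner (defect C (subspace_incl y)) x = rinner y (defect_to C x).
Proof. by move=> C1; rewrite rinner_defect. Qed.

(** An instance of [colligation] for [L]. *)
Lemma julia_contractive (R : realType) (H K : hilbertType R) (L : {linear H -> K}) :
  contractive_op L -> contractive_op (julia L).
Proof.
move=> L1; apply/contractive_sqn => -[p l].
rewrite !sqn_hsum /=.
have := colligation (subspace_incl l) p L1.
have -> : sqn (- L (subspace_incl l) + defect (adj L) p) =
    sqn (defect_to (adj L) p - corestr (defect_subspace (adj L)) (L (subspace_incl l))).
  rewrite -[RHS]/(sqn (subspace_incl _)) subspace_inclD subspace_inclN corestr_map//.
  by rewrite addrC.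
rewrite [_ + adj L p]addrC -[sqn (subspace_incl l)]/(sqn l) => e.
by rewrite addrC e addrC.
Qed.

Lemma unitary_contractive (R : realType) (H K : hilbertType R) (U : H -> K) :
  unitary_op U -> contractive_op U.
Proof. by move=> [U_iso _]; apply/contractive_sqn => x; rewrite /sqn U_iso. Qed.

Lemma op_invK (R : realType) (H K : hilbertType R) (U : H -> K) :
  unitary_op U -> cancel (op_inv U) U.
Proof. by move=> [_ UT] y; apply: pinvK; rewrite UT inE. Qed.

Lemma op_inv_contractive (R : realType) (H K : hilbertType R) (U : H -> K) :
  unitary_op U -> contractive_op (op_inv U).
Proof.
move=> Uu; apply/contractive_sqn => y.
by rewrite -[in leRHS](op_invK Uu y) /sqn Uu.1.
Qed.

Lemma fock_splitE (R : realType) (n : nat) (H K : hilbertType R)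
    (u : fock n (hsum H K)) w :
  (val (fock_split u).1 w, val (fock_split u).2 w) = val u w.
Proof.
have fst1 : contractive_op (fun x : hsum H K => x.1).
  by apply/contractive_sqn => x; rewrite sqn_hsum lerDl sqn_ge0.
have snd1 : contractive_op (fun x : hsum H K => x.2).
  by apply/contractive_sqn => x; rewrite sqn_hsum lerDr sqn_ge0.
rewrite /= (val_fock_map _ _ fst1) (val_fock_map _ _ snd1).
by rewrite -surjective_pairing.
Qed.

Lemma fock_join_diag (R : realType) (n : nat) (H H' K : hilbertType R)
    (phi : fock n H -> fock n H') (u : hsum (fock n H) (fock n K)) w :
  val (fock_join (opmx phi (fun=> 0) (fun=> 0) id u)) w = (val (phi u.1) w, val u.2 w).
Proof. by rewrite fock_joinE /opmx addr0 add0r. Qed.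

(** * The characteristic function as an output *)

(** The converse reading of [charfunE]: the output at [r = 1] lies coefficientwise
    in the defect space, so it is a legitimate candidate for the limit. *)
Lemma theta_rel_charfun (R : realType) (n : nat) (H : hilbertType R)
    (T : 'I_n -> {linear H -> H}) (f : fock n (defect_space (row_op T))) :
  contractive_op (row_op T) ->
  theta_rel (row_op T) 1 (fun w => subspace_incl (val f w))
    (fun w => subspace_incl (val (charfun T f) w)).
Proof.
move=> T1; have incl1 := @subspace_incl_contractive R.
pose f' := fock_map (@subspace_incl _ _ _) f.
have f'E : val f' = fun w => subspace_incl (val f w).
  by apply/funext => w; rewrite val_fock_map.
have [g0 fg0] := theta_rel_exists (row_op T) 1 (val f').
have g0F : fock_pred g0 by apply: (theta_rel_fock T1 _ fg0); rewrite ler01 lexx.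
have [x [x0 xS g0E]] := fg0.
pose g w : defect_space (adj (row_op T)) :=
  defect_to (adj (row_op T)) (x w) -
  corestr (defect_subspace (adj (row_op T))) (row_op T (subspace_incl (val f w))).
have gE w : subspace_incl (g w) = g0 w.
  by rewrite subspace_inclD subspace_inclN corestr_map// g0E f'E addrC.
have gF : fock_pred g.
  by apply: (fock_pred_le (M := 1) (u := g0)) => // w; rewrite mul1r -gE.
rewrite (charfunE (g := Sub g gF) T1) /=.
  rewrite (_ : (fun w => subspace_incl (g w)) = g0); last by apply/funext.
  by rewrite -f'E.
rewrite (_ : (fun w => subspace_incl (g w)) = g0); last by apply/funext.
by rewrite -f'E.
Qed.

(** * The cascade *)

Section Cascade.
Variables (R : realType) (n : nat) (H1 H2 : hilbertType R).
Variables (A : {linear hpow 'I_n H1 -> H1}) (B : {linear hpow 'I_n H2 -> H2}).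
Variable L : {linear defect_space B -> defect_space (adj A)}.
Variable T : {linear hpow 'I_n (hsum H1 H2) -> hsum H1 H2}.
Variable sigma : {linear defect_space T -> hsum (defect_space A) (defect_space L)}.
Variable sigma_s : {linear defect_space (adj T) ->
  hsum (defect_space (adj B)) (defect_space (adj L))}.
Hypotheses (A1 : contractive_op A) (B1 : contractive_op B).
Hypotheses (L1 : contractive_op L) (T1 : contractive_op T).
Hypothesis TE : forall h, T h =
  opmx A (fun h2 => defect (adj A) (subspace_incl (L (defect_to B h2))))
       (fun=> 0) B (hpow_split h).
Hypotheses (sU : unitary_op sigma) (ssU : unitary_op sigma_s).
Hypothesis sE : forall h, (subspace_incl (sigma (defect_to T h)).1,
    (sigma (defect_to T h)).2) =
  opmx (defect A) (fun h2 => - adj A (subspace_incl (L (defect_to B h2))))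
       (fun=> 0) (fun h2 => defect_to L (defect_to B h2)) (hpow_split h).
Hypothesis ssE : forall h, (subspace_incl (sigma_s (defect_to (adj T) h)).1,
    (sigma_s (defect_to (adj T) h)).2) =
  opmx (fun h1 => - B (subspace_incl (adj L (defect_to (adj A) h1))))
       (defect (adj B))
       (fun h1 => defect_to (adj L) (defect_to (adj A) h1)) (fun=> 0) h.

Let A1' := adj_contractive A1.
Let B1' := adj_contractive B1.
Let L1' := adj_contractive L1.
Let T1' := adj_contractive T1.

Lemma adj_block x : hpow_split (adj T x) =
  (adj A x.1,
   defect B (subspace_incl (adj L (defect_to (adj A) x.1))) + adj B x.2).
Proof.
apply: rinner_injl => z; rewrite -[z in LHS]hpow_joinK rinner_split.
rewrite rinnerC [LHS]rinner_adjr// adjK//.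
rewrite TE hpow_joinK !rinner_hsum/= add0r.
set b := defect_to B z.2; set c := defect_to (adj A) x.1.
have e1 : rinner (A z.1) x.1 = rinner (adj A x.1) z.1.
  by rewrite (rinner_adj A1) rinnerC.
have e2 : rinner (B z.2) x.2 = rinner (adj B x.2) z.2.
  by rewrite (rinner_adj B1) rinnerC.
have e3 : rinner (defect (adj A) (subspace_incl (L b))) x.1 = rinner (L b) c.
  exact: (rinner_defect_to (L b) x.1 A1').
have e4 : rinner (defect B (subspace_incl (adj L c))) z.2 = rinner (adj L c) b.
  exact: (rinner_defect_to (adj L c) z.2 B1).
have e5 : rinner (L b) c = rinner (adj L c) b.
  by rewrite (rinner_adj L1) rinnerC.
by rewrite (rinnerDl (A z.1)) (rinnerDl (defect B _)) e1 e2 e3 e4 e5 addrA.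
Qed.

(** The first component of the Julia-Halmos matrix at [(- p, l)]; with [p] equal
    to [A a] it is the part of the input of [B] which does not come from the
    state of [A]. *)
Let juliaN_fst (p : defect_space (adj A)) (l : defect_space L) : defect_space B :=
  - adj L p + defect L (subspace_incl l).

(** Since [defect T] is self-adjoint and [sigma] unitary, pairing with a vector
    [z] moves [defect T] to [z], where the defining formula of [sigma] applies. *)
Lemma defect_block f p : subspace_incl p = A (subspace_incl (sigma f).1) ->
  hpow_split (defect T (subspace_incl f)) =
  (defect A (subspace_incl (sigma f).1),
   defect B (subspace_incl (juliaN_fst p (sigma f).2))).
Proof.
set a := (sigma f).1; set l := (sigma f).2; set q := juliaN_fst p l => pE.
apply: rinner_injl => z; rewrite -[z in LHS]hpow_joinK rinner_split.
set b := defect_to B z.2.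
have e0 : rinner (defect T (subspace_incl f)) (hpow_join z) =
    rinner (sigma f) (sigma (defect_to T (hpow_join z))).
  by rewrite (rinner_defect_to f _ T1) /rinner sU.1.
have [s1 s2] : subspace_incl (sigma (defect_to T (hpow_join z))).1 =
      defect A z.1 - adj A (subspace_incl (L b)) /\
    (sigma (defect_to T (hpow_join z))).2 = defect_to L b.
  by have := sE (hpow_join z); rewrite hpow_joinK /opmx/= add0r => -[-> ->].
have e1 : rinner (subspace_incl a) (defect A z.1) =
    rinner (defect A (subspace_incl a)) z.1 by rewrite (rinner_defect A1).
have e2 : rinner (subspace_incl a) (adj A (subspace_incl (L b))) = rinner (adj L p) b.
  by rewrite -(rinner_adj A1) -pE rinner_incl (rinner_adjr L1).
have e3 : rinner (defect B (subspace_incl q)) z.2 =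
    - rinner (adj L p) b + rinner (defect L (subspace_incl l)) b.
  by rewrite (rinner_defect_to q z.2 B1) /q /juliaN_fst rinnerDl rinnerNl.
have e4 : rinner (defect L (subspace_incl l)) b = rinner l (defect_to L b).
  exact: (rinner_defect_to l b L1).
rewrite e0 rinner_hsum s2 -/l -/a -rinner_incl s1 rinnerBr e1 e2.
by rewrite [RHS]rinner_hsum /= e3 e4 addrA.
Qed.

(** Both sides are tested against the range of [defect (adj T)], which is dense in
    the defect space: on the left by the formula defining [sigma_s], on the
    right through [T (defect T f)] and [defect_block]. *)
Lemma output_block f p t : subspace_incl p = A (subspace_incl (sigma f).1) ->
  subspace_incl (sigma_s t).1 = B (subspace_incl (juliaN_fst p (sigma f).2)) ->
  (sigma_s t).2 = defect_to (adj L) p +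
    corestr (defect_subspace (adj L)) (L (subspace_incl (sigma f).2)) ->
  subspace_incl t = T (subspace_incl f).
Proof.
move=> pE; set a := (sigma f).1; set l := (sigma f).2; set q := juliaN_fst p l => t1 t2.
have [tf tfE] : exists tf : defect_space (adj T),
    subspace_incl tf = T (subspace_incl f).
  by exists (Sub (T (subspace_incl f)) (defect_space_map f T1)).
rewrite -tfE; congr subspace_incl; apply/subr0_eq/defect_space_eq0 => h.
rewrite subspace_inclD subspace_inclN rinnerBl; apply/eqP; rewrite subr_eq0; apply/eqP.
set c := defect_to (adj A) h.1.
have [s1 s2] : subspace_incl (sigma_s (defect_to (adj T) h)).1 =
      - B (subspace_incl (adj L c)) + defect (adj B) h.2 /\
    (sigma_s (defect_to (adj T) h)).2 = defect_to (adj L) c.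
  by have := ssE h; rewrite /opmx/= addr0 => -[-> ->].
have lhs : rinner (subspace_incl t) (defect (adj T) h) =
    rinner (B (subspace_incl q)) (defect (adj B) h.2 - B (subspace_incl (adj L c))) +
    rinner (defect_to (adj L) p + corestr (defect_subspace (adj L)) (L (subspace_incl l)))
           (defect_to (adj L) c).
  rewrite -(rinner_defect T1') (rinner_defect_to t h T1') -[LHS]/(complex.Re _) -ssU.1.
  rewrite -/(rinner _ _) rinner_hsum t2 s2 -[X in X + _]rinner_incl t1 s1.
  by rewrite [- B _ + _]addrC.
have rhs : rinner (subspace_incl tf) (defect (adj T) h) =
    rinner p c + rinner (adj L c) (defect_to B (defect B (subspace_incl q))) +
    rinner (B (subspace_incl q)) (defect (adj B) h.2).
  rewrite tfE -(rinner_defect T1') -(defect_comm _ T1) TE (defect_block pE).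
  rewrite rinner_hsum /= add0r -/q (rinnerDl (A _)).
  rewrite (defect_comm _ A1) -pE (rinner_defect_to p h.1 A1') -/c.
  rewrite (rinner_defect_to _ h.1 A1') (rinner_adj L1) -/c (rinnerC (adj L c)).
  by rewrite (defect_comm _ B1) (rinner_defect B1').
rewrite lhs rhs rinnerBr.
have e1 : rinner (adj L c) (defect_to B (defect B (subspace_incl q))) =
    rinner q (adj L c) - rinner (B (subspace_incl q)) (B (subspace_incl (adj L c))).
  rewrite rinnerC -[LHS]rinner_incl -[LHS]/(rinner (defect B (defect B _)) _).
  by rewrite (defect_sq B1) rinnerBl rinner_incl -(rinner_adjr B1).
have e2 : rinner (defect_to (adj L) p) (defect_to (adj L) c) =
    rinner p c - rinner (adj L p) (adj L c).
  rewrite -rinner_incl -[LHS]/(rinner (defect (adj L) p) (defect (adj L) c)).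
  rewrite (rinner_defect L1') (defect_sq L1') rinnerBr; congr (_ - _).
  by rewrite (adjK L1) (rinner_adjr L1).
have e3 : rinner (corestr (defect_subspace (adj L)) (L (subspace_incl l)))
      (defect_to (adj L) c) = rinner (defect L (subspace_incl l)) (adj L c).
  rewrite -rinner_incl corestr_map//.
  rewrite -[LHS]/(rinner (L (subspace_incl l)) (defect (adj L) c)).
  by rewrite -(rinner_defect L1') -(defect_comm _ L1) (rinner_adj L1).
have e4 : rinner q (adj L c) =
    - rinner (adj L p) (adj L c) + rinner (defect L (subspace_incl l)) (adj L c).
  by rewrite /q /juliaN_fst rinnerDl rinnerNl.
rewrite rinnerDl e1 e2 e3 e4.
move: (rinner (B _) _) (rinner (B _) _) (rinner p c) (rinner (defect L _) _).
move: (rinner (adj L p) _) => *; ring.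
Qed.

(** Pairing the states of [A] and [B] gives the state of [T].  The output is
    identified by subtracting the contribution of the state and applying
    [output_block] to the remainder. *)
Lemma theta_cascade (r : R) (f : seq 'I_n -> defect_space T)
    (al : seq 'I_n -> defect_space (adj A)) (be : seq 'I_n -> defect_space (adj B))
    (t : seq 'I_n -> defect_space (adj T)) :
  theta_rel A r (fun w => subspace_incl (sigma (f w)).1) (fun w => subspace_incl (al w)) ->
  theta_rel B r (fun w => subspace_incl (julia L (al w, (sigma (f w)).2)).1)
    (fun w => subspace_incl (be w)) ->
  (forall w, sigma_s (t w) = (be w, (julia L (al w, (sigma (f w)).2)).2)) ->
  theta_rel T r (fun w => subspace_incl (f w)) (fun w => subspace_incl (t w)).
Proof.
move=> [x1 [x10 x1S alE]] [x2 [x20 x2S beE]] tE.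
pose c w := defect_to (adj A) (x1 w).
pose p w := c w - al w.
have pE w : subspace_incl (p w) = A (subspace_incl (sigma (f w)).1).
  rewrite subspace_inclD subspace_inclN alE opprD opprK.
  by rewrite [subspace_incl _]/(defect (adj A) (x1 w)) addrCA subrr addr0.
pose q w := juliaN_fst (p w) (sigma (f w)).2.
have bE w : subspace_incl (julia L (al w, (sigma (f w)).2)).1 =
    subspace_incl (q w) + subspace_incl (adj L (c w)).
  rewrite -subspace_inclD; congr subspace_incl; rewrite /q /juliaN_fst /p /=.
  by rewrite linearB/= opprB [RHS]addrAC subrK.
pose x w : hsum H1 H2 := (x1 w, x2 w).
exists x; split.
- by rewrite /x x10 x20.
- move=> w j; have := adj_block (x w); have := defect_block (pE w).
  move=> [/ffunP/(_ j) d1 /ffunP/(_ j) d2] [/ffunP/(_ j) a1 /ffunP/(_ j) a2].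
  rewrite /x x1S x2S; rewrite !ffunE in d1 d2 a1 a2.
  rewrite ffunE; congr pair; congr (_ *: _).
    by rewrite ffunE /= d1 a1.
  by rewrite !ffunE /= d2 a2 bE linearD !ffunE addrA.
- move=> w; pose t2 := defect_to (adj T) (x w) - t w.
  have [s1 s2] : subspace_incl (sigma_s (defect_to (adj T) (x w))).1 =
        - B (subspace_incl (adj L (c w))) + defect (adj B) (x2 w) /\
      (sigma_s (defect_to (adj T) (x w))).2 = defect_to (adj L) (c w).
    by have := ssE (x w); rewrite /opmx/= addr0 => -[-> ->].
  have t2E : subspace_incl t2 = T (subspace_incl (f w)).
    apply: (output_block (pE w)).
      rewrite /t2 linearB tE -[(_ - _).1]/((_).1 - be w).
      rewrite subspace_inclD subspace_inclN s1 beE bE linearD/=.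
      by rewrite opprK (linearD B) addrACA subrr addr0 addrC addrK.
    rewrite /t2 linearB tE /= s2.
    rewrite opprD opprK addrA; congr (_ + _).
    apply: subspace_incl_inj; rewrite subspace_inclD subspace_inclN.
    by rewrite /p -[RHS]/(defect (adj L) (c w - al w)) linearB.
  rewrite -t2E /t2 subspace_inclD subspace_inclN opprD opprK.
  by rewrite -[X in - X + _]/(defect (adj T) (x w)) addrAC addNr add0r.
Qed.

(** [phiA] and [phiB] stand for the characteristic functions, of which only the
    input-output relation matters. *)
Lemma theta_fock_cascade (r : R)
    (phiA : fock n (defect_space A) -> fock n (defect_space (adj A)))
    (phiB : fock n (defect_space B) -> fock n (defect_space (adj B)))
    (f : fock n (defect_space T)) :
  (forall a, theta_rel A r (fun w => subspace_incl (val a w))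
     (fun w => subspace_incl (val (phiA a) w))) ->
  (forall b, theta_rel B r (fun w => subspace_incl (val b w))
     (fun w => subspace_incl (val (phiB b) w))) ->
  theta_rel T r (fun w => subspace_incl (val f w))
    (fun w => subspace_incl (val (fock_map (op_inv sigma_s)
      (fock_join (opmx phiB (fun=> 0) (fun=> 0) id
        (fock_split (fock_map (julia L)
          (fock_join (opmx phiA (fun=> 0) (fun=> 0) id
            (fock_split (fock_map sigma f))))))))) w)).
Proof.
move=> phiAP phiBP; set a := fock_split (fock_map sigma f).
set b := fock_split (fock_map (julia L) _).
have aE w : (val a.1 w, val a.2 w) = sigma (val f w).
  by rewrite fock_splitE val_fock_map//; exact: unitary_contractive.
have bE w : (val b.1 w, val b.2 w) = julia L (val (phiA a.1) w, val a.2 w).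
  by rewrite fock_splitE val_fock_map ?fock_join_diag//; exact: julia_contractive.
apply: (theta_cascade (al := val (phiA a.1)) (be := val (phiB b.1))).
- have := phiAP a.1; congr theta_rel.
  by apply/funext => w; rewrite -aE.
- have := phiBP b.1; congr theta_rel.
  by apply/funext => w; rewrite -aE -bE.
- move=> w; rewrite val_fock_map; last exact: op_inv_contractive.
  by rewrite op_invK// fock_join_diag -aE -bE.
Qed.

End Cascade.

Theorem theorem3p2 (R : realType) (n : nat) (H1 H2 : hilbertType R)
  (A : 'I_n -> {linear H1 -> H1}) (B : 'I_n -> {linear H2 -> H2})
  (L : {linear defect_space (row_op B) -> defect_space (adj (row_op A))})
  (T : 'I_n -> {linear hsum H1 H2 -> hsum H1 H2})
  (sigma : {linear defect_space (row_op T) ->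
              hsum (defect_space (row_op A)) (defect_space L)})
  (sigma_s : {linear defect_space (adj (row_op T)) ->
              hsum (defect_space (adj (row_op B))) (defect_space (adj L))}) :
  (0 < n)%N ->
  contractive_op (row_op A) -> contractive_op (row_op B) -> contractive_op L ->
  contractive_op (row_op T) ->
  (forall h, row_op T h =
     opmx (row_op A)
          (fun h2 => defect (adj (row_op A)) (subspace_incl (L (defect_to (row_op B) h2))))
          (fun=> 0) (row_op B) (hpow_split h)) ->
  unitary_op sigma -> unitary_op sigma_s ->
  (forall h, (subspace_incl (sigma (defect_to (row_op T) h)).1,
              (sigma (defect_to (row_op T) h)).2) =
     opmx (defect (row_op A))
          (fun h2 => - adj (row_op A) (subspace_incl (L (defect_to (row_op B) h2))))
          (fun=> 0) (fun h2 => defect_to L (defect_to (row_op B) h2))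
          (hpow_split h)) ->
  (forall h, (subspace_incl (sigma_s (defect_to (adj (row_op T)) h)).1,
              (sigma_s (defect_to (adj (row_op T)) h)).2) =
     opmx (fun h1 => - row_op B (subspace_incl (adj L (defect_to (adj (row_op A)) h1))))
          (defect (adj (row_op B)))
          (fun h1 => defect_to (adj L) (defect_to (adj (row_op A)) h1)) (fun=> 0)
          h) ->
  forall f, charfun T f =
    fock_map (op_inv sigma_s)
      (fock_join (opmx (charfun B) (fun=> 0) (fun=> 0) id
        (fock_split (fock_map (julia L)
          (fock_join (opmx (charfun A) (fun=> 0) (fun=> 0) id
            (fock_split (fock_map sigma f)))))))).
Proof.
move=> _ A1 B1 L1 T1 TE sU ssU sE ssE f; apply: charfunE => //.
apply: (@theta_fock_cascade R n H1 H2 (row_op A) (row_op B) L (row_op T)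
  sigma sigma_s A1 B1 L1 T1 TE sU ssU sE ssE 1 (charfun A) (charfun B) f).
  by move=> a; exact: theta_rel_charfun.
by move=> b; exact: theta_rel_charfun.
Qed.
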